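(* For any two integer sequences $(\kappa_n)$ and $(d_n)$ such that $\kappa_n\to\infty$ and $d_n\to\infty$ as $n\to\infty$, the critical times of constrained-degree percolation with constraint $\kappa_n$ on the hypercubic lattice $\mathbb{L}^{d_n}$ satisfy $$\lim_{n\to\infty} d_n\cdot t_{\mathrm{c}}^{\kappa_n}(d_n)=\frac12.$$
   Context: Constrained-degree percolation. Let $G=(\mathbb{V},\mathbb{E})$ be an infinite connected transitive graph of finite degree and let $\kappa$ be a positive integer (the constraint). Let $(U_e)_{e\in\mathbb{E}}$ be i.i.d. uniform random variables on $[0,1]$ (clocks), with law $\mathbb{P}$ the product of Lebesgue measures on $[0,1]^{\mathbb{E}}$. At time $0$ all bonds are closed. Each bond $e$ tries to open at time $U_e$ and succeeds if and only if, at that time, each of its two end-vertices belongs to at most $\kappa-1$ open bonds; once open, a bond stays open, and a bond which fails to open stays closed forever. Formally, for $t\in[0,1]$ the configuration $\omega^{G,\kappa}(t)\in\{0,1\}^{\mathbb{E}}$ (1 = open, 0 = closed) is such that $\omega^{G,\kappa}_{v_1v_2}(t)$ is the indicator of the intersection of the events $\{U_{v_1v_2}\le t\}$ and, for $i\in\{1,2\}$, $$\left\{\left|\left\{u\in\mathbb{V}\setminus\{v_{3-i}\}: v_iu\in\mathbb{E},\ \omega^{G,\kappa}_{v_iu}(U_{v_1v_2})=1\right\}\right|<\kappa\right\}.$$ This determines $\omega^{G,\kappa}$ almost surely (Harris graphical construction). If $\kappa\ge\deg(G)$ the constraint is void and $\omega^{G,\kappa}(t)$ is ordinary Bernoulli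 bond percolation with parameter $t$. Let $\theta^{G,\kappa}(t)=\mathbb{P}(0\leftrightarrow\infty \text{ in }\omega^{G,\kappa}(t))$, where $0$ is a fixed vertex (the origin) and $0\leftrightarrow\infty$ means that infinitely many vertices are connected to $0$ by paths of open bonds. The function $\theta^{G,\kappa}$ is non-decreasing in $t$ and the critical time is $t_{\mathrm{c}}^{G,\kappa}=\sup\{t\in[0,1]:\theta^{G,\kappa}(t)=0\}$. The hypercubic lattice is $\mathbb{L}^d=(\mathbb{Z}^d,\mathbb{E}^d)$ with $\mathbb{E}^d=\{uv: u,v\in\mathbb{Z}^d,\ \|u-v\|_1=1\}$, and $t_{\mathrm{c}}^{\kappa}(d):=t_{\mathrm{c}}^{\mathbb{L}^d,\kappa}$. *)

(* Defs.v *)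
From HB Require Import structures.
From mathcomp Require Import all_boot all_order all_algebra.
From mathcomp Require Import finmap.
From mathcomp Require Import all_classical all_reals all_analysis.

Set Implicit Arguments.
Unset Strict Implicit.
Unset Printing Implicit Defensive.

Import Order.TTheory GRing.Theory Num.Theory.
Import numFieldNormedType.Exports.

Local Open Scope classical_set_scope.
Local Open Scope ring_scope.

(* A graph is given by its adjacency relation [adj : rel V]; the bond joining
   u and v is the unordered pair [fset u; v].  Families indexed by bonds are
   indexed by all of {fset V}, and only their values on [bonds adj] matter. *)
Definition bonds (V : choiceType) (adj : rel V) : set {fset V} :=
  [set e | exists u v : V, adj u v /\ e = [fset u; v]%fset].

Definition lattice_adj (d : nat) : rel 'rV[int]_d :=
  fun u v => \sum_(i < d) `|u 0 i - v 0 i| == 1.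

Definition iid_uniform_clocks (R : realType) (V : choiceType) (adj : rel V)
    (disp : measure_display) (T : measurableType disp) (P : probability T R)
    (U : {fset V} -> {RV P >-> R}) : Prop :=
  (forall e, bonds adj e -> forall B : set R, measurable B ->
     distribution P (U e) B = uniform_prob (ltr01 : 0 < 1 :> R) B) /\
  (forall (J : {fset {fset V}}) (B : {fset V} -> set R),
     [set` J] `<=` bonds adj -> (forall e, measurable (B e)) ->
     P (\bigcap_(e in [set` J]) (U e @^-1` B e)) =
       (\prod_(e <- J) P (U e @^-1` B e))%E).

(* Number of open bonds at v other than the one towards v'.  [fset_set] is the
   intended finite set only when [adj] is locally finite, as for
   [lattice_adj d]. *)
Definition open_degree (V : choiceType) (adj : rel V) (c : {fset V} -> bool)
    (v v' : V) : nat :=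
  #|` fset_set [set u | [/\ u != v', adj v u & c [fset v; u]%fset]] |.

(* The rule of the dynamics for one realisation of the clocks: [c t e] is the
   state of e at time t.  The constraint is tested at time [U e], not t. *)
Definition cdp_rule (R : realType) (V : choiceType) (adj : rel V)
    (kappa : nat) (U : {fset V} -> R) (c : R -> {fset V} -> bool) : Prop :=
  forall (t : R) (v1 v2 : V), 0 <= t <= 1 -> adj v1 v2 ->
    let e := [fset v1; v2]%fset in
    c t e = [&& U e <= t,
                (open_degree adj (c (U e)) v1 v2 < kappa)%N &
                (open_degree adj (c (U e)) v2 v1 < kappa)%N].

(* The rule determines the configuration only almost surely, so a realisation
   of the process is any family of random variables obeying it a.s. *)
Definition constrained_degree_percolation (R : realType) (V : choiceType)
    (adj : rel V) (kappa : nat) (disp : measure_display)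
    (T : measurableType disp) (P : probability T R)
    (U : {fset V} -> {RV P >-> R}) (omega : R -> {fset V} -> T -> bool)
    : Prop :=
  [/\ iid_uniform_clocks adj U,
      (forall t e, 0 <= t <= 1 -> bonds adj e ->
         measurable_fun [set: T] (omega t e)) &
      {ae P, forall w : T,
         cdp_rule adj kappa (fun e => U e w) (fun t e => omega t e w)}].

Definition connected_by_open (V : choiceType) (adj : rel V)
    (c : {fset V} -> bool) (x y : V) : Prop :=
  exists p : seq V,
    path (fun u v => adj u v && c [fset u; v]%fset) x p /\ last x p = y.

Definition percolates (V : choiceType) (adj : rel V) (c : {fset V} -> bool)
    (o : V) : Prop :=
  infinite_set [set x | connected_by_open adj c o x].

Definition theta (R : realType) (V : choiceType) (adj : rel V) (o : V)
    (disp : measure_display) (T : measurableType disp) (P : probability T R)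
    (omega : R -> {fset V} -> T -> bool) (t : R) : \bar R :=
  P [set w | percolates adj (fun e => omega t e w) o].

Definition critical_time (R : realType) (V : choiceType) (adj : rel V) (o : V)
    (disp : measure_display) (T : measurableType disp) (P : probability T R)
    (omega : R -> {fset V} -> T -> bool) : R :=
  sup [set t : R | 0 <= t <= 1 /\ theta adj o P omega t = 0%E].

(* Main.v *)
(** Lower bound: an open bond has rung, so the origin percolates at time t only
    if for every n some self-avoiding walk of length n has rung by time t; the
    expected number of such walks is at most (2dt)^n.

    Upper bound: fix t = (1 + eps) / (2d).  A bond which has rung by time t, and
    both ends of which have at most kappa bonds that have rung by time t, is
    open.  Paths of such bonds are found by the second moment method.  They are
    made of blocks: a positive step in one of m ~ d / q "time" directions, then
    l steps in distinct other directions.  Since 1 / m is paid only once per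
    block, the number of blocks beats t^-(l+1) when l is large.  Blocks of two
    paths can share vertices only if the time coordinates of the paths agree.
    The difference D of the time coordinates of two independent paths is a
    high-dimensional random walk, and 1 / (|D|^2 + 16) is superharmonic for it
    with a definite drift; this yields a Lyapunov function which bounds, uniformly
    in the number of blocks, the expected correlation weight of two paths.  The
    degree constraint is decoupled by Harris' inequality and by closing the few
    bonds which join the two paths, at the cost of a factor 1 + O(1/d) each. *)

Require Import Defs.
From HB Require Import structures.
From mathcomp Require Import all_boot all_order all_algebra.
From mathcomp Require Import finmap.
From mathcomp Require Import all_classical all_reals all_analysis.
From mathcomp Require Import lra ring zify.

Set Implicit Arguments.
Unset Strict Implicit.
Unset Printing Implicit Defensive.

Import Order.TTheory GRing.Theory Num.Theory.
Import numFieldNormedType.Exports.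

Local Open Scope ring_scope.

(** * Independent bonds *)

(** The sufficient condition for openness removes the dynamics: it only asks which bonds have rung
    by one fixed time, which is a product measure. It still combines an increasing requirement (the
    path has rung) with a decreasing one (few bonds have rung around it). Forcing the bonds of the
    path open leaves a decreasing event on the remaining bonds, and Harris' inequality is applied to
    that part.

    In the second moment each path is weighted by the inverse of its probability, so only ratios of
    joint to separate probabilities are needed. Such a ratio is at most a product over pairs of
    blocks of equal index, which is why a Lyapunov function can be iterated one block at a time: a
    constant for paths at the same vertex, 2 for equal times only, and close to 1 otherwise. The
    constraint enters through Markov's inequality: a threshold depending on eps alone makes the
    degree condition at a vertex hold with probability at least 1 - eps / 8. *)

Section BernoulliExpectation.
Variables (R : realFieldType) (E : eqType) (p : R).
Hypothesis p01 : 0 <= p <= 1.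
Implicit Types (s l : seq E) (F G : (E -> bool) -> R) (A B : (E -> bool) -> bool).
Implicit Types (c : E -> bool) (D : pred E).

Definition upd c e b : E -> bool := fun x => if x == e then b else c x.

(* Expectation over independent bonds; those outside s are closed. *)
Fixpoint Ex s F : R :=
  if s is e :: s' then
    p * Ex s' (fun c => F (upd c e true)) +
    (1 - p) * Ex s' (fun c => F (upd c e false))
  else F (fun=> false).

Definition pr s A : R := Ex s (fun c => (A c)%:R).

Definition depends_on T D (F : (E -> bool) -> T) :=
  forall c c', (forall e, D e -> c e = c' e) -> F c = F c'.

Definition increasing F := forall c c', (forall e, c e -> c' e) -> F c <= F c'.
Definition decreasing A := forall c c', (forall e, c e -> c' e) -> A c' -> A c.

Lemma eq_Ex s F G : F =1 G -> Ex s F = Ex s G.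
Proof.
elim: s F G => [|e s IH] F G FG /=; first exact: FG.
by congr (_ * _ + _ * _); apply: IH => c; apply: FG.
Qed.

Lemma le_Ex s F G : (forall c, F c <= G c) -> Ex s F <= Ex s G.
Proof.
case/andP: p01 => p0 p1.
elim: s F G => [|e s IH] F G FG /=; first exact: FG.
by apply: lerD; apply: ler_wpM2l; rewrite ?subr_ge0 //; apply: IH => c; apply: FG.
Qed.

Lemma Ex_cst s (a : R) : Ex s (fun=> a) = a.
Proof. by elim: s => //= e s ->; ring. Qed.

Lemma ExD s F G : Ex s (fun c => F c + G c) = Ex s F + Ex s G.
Proof. by elim: s F G => //= e s IH F G; rewrite !IH; ring. Qed.

Lemma ExZ s a F : Ex s (fun c => a * F c) = a * Ex s F.
Proof. by elim: s F => //= e s IH F; rewrite !IH; ring. Qed.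

Lemma Ex_sum s (I : Type) (r : seq I) (F : I -> (E -> bool) -> R) :
  Ex s (fun c => \sum_(i <- r) F i c) = \sum_(i <- r) Ex s (F i).
Proof.
elim: r => [|i r IH].
  by rewrite big_nil -[RHS](Ex_cst s); apply: eq_Ex => c; rewrite big_nil.
rewrite big_cons -IH -ExD; apply: eq_Ex => c.
by rewrite big_cons.
Qed.

Lemma Ex_ge0 s F : (forall c, 0 <= F c) -> 0 <= Ex s F.
Proof. by move=> F0; rewrite -(Ex_cst s 0); apply: le_Ex. Qed.

Lemma depends_on_upd T D (F : (E -> bool) -> T) e b :
  depends_on D F -> depends_on D (fun c => F (upd c e b)).
Proof. by move=> dF c c' cc'; apply: dF => x Dx; rewrite /upd; case: ifP => // _; apply: cc'. Qed.

Lemma depends_on_updE T D (F : (E -> bool) -> T) e b c :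
  depends_on D F -> ~~ D e -> F (upd c e b) = F c.
Proof. by move=> dF De; apply: dF => x Dx; rewrite /upd; case: eqP => // xe; move: De;
  rewrite -xe Dx. Qed.

Lemma Ex_indep s D D' F G : depends_on D F -> depends_on D' G ->
    (forall e, D e -> D' e -> false) ->
  Ex s (fun c => F c * G c) = Ex s F * Ex s G.
Proof.
move=> + + DD'; elim: s F G => [//|e s IH] F G dF dG /=.
rewrite !IH; try exact: depends_on_upd.
have [De|De] := boolP (D e).
  have D'e : ~~ D' e by apply/negP => /(DD' _ De).
  rewrite !(eq_Ex (F := fun c => G (upd c e _)) s
    (fun c => depends_on_updE _ c dG D'e)); ring.
rewrite !(eq_Ex (F := fun c => F (upd c e _)) s
  (fun c => depends_on_updE _ c dF De)); ring.
Qed.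

(** Harris' inequality by induction on the bonds: conditioning on the first one leaves Chebyshev's
    inequality for two increasing functions on a two-point space. *)
Lemma Ex_harris s F G : increasing F -> increasing G ->
  Ex s F * Ex s G <= Ex s (fun c => F c * G c).
Proof.
case/andP: p01 => p0 p1.
have inc_upd F' e b : increasing F' -> increasing (fun c => F' (upd c e b)).
  by move=> iF c c' cc'; apply: iF => x; rewrite /upd; case: eqP => // _ /cc'.
elim: s F G => [//|e s IH] F G iF iG /=.
have le_upd F' : increasing F' ->
    Ex s (fun c => F' (upd c e false)) <= Ex s (fun c => F' (upd c e true)).
  by move=> iF'; apply: le_Ex => c; apply: iF' => x; rewrite /upd; case: eqP.
have h1 := IH _ _ (inc_upd _ e true iF) (inc_upd _ e true iG).
have h0 := IH _ _ (inc_upd _ e false iF) (inc_upd _ e false iG).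
have f01 := le_upd F iF; have g01 := le_upd G iG.
move: h1 h0 f01 g01 => /=.
set f1 := Ex s (fun c => F (upd c e true)); set f0 := Ex s (fun c => F _).
set g1 := Ex s (fun c => G (upd c e true)); set g0 := Ex s (fun c => G _).
set a1 := Ex s _; set a0 := Ex s _ => h1 h0 f01 g01.
(* This product is the covariance of the two conditional means given the state of [e]. *)
have hh : 0 <= p * (1 - p) * ((f1 - f0) * (g1 - g0)).
  by rewrite !mulr_ge0 ?subr_ge0.
have k1 := ler_wpM2l p0 h1.
have q0 : 0 <= 1 - p by rewrite subr_ge0.
have k0 := ler_wpM2l q0 h0.
rewrite -/f1 -/g1 -/f0 -/g0.
apply: le_trans (lerD k1 k0); rewrite -subr_ge0.
by apply: le_trans hh _; rewrite le_eqVlt; apply/orP; left; apply/eqP; ring.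
Qed.

Lemma eq_pr s A B : A =1 B -> pr s A = pr s B.
Proof. by move=> AB; apply: eq_Ex => c; rewrite AB. Qed.

Lemma le_pr s A B : (forall c, A c -> B c) -> pr s A <= pr s B.
Proof.
by move=> AB; apply: le_Ex => c; rewrite ler_nat; case: (A c) (AB c) => // ->.
Qed.

Lemma pr_ge0 s A : 0 <= pr s A.
Proof. by apply: Ex_ge0 => c; rewrite ler0n. Qed.

Lemma prT s : pr s (fun=> true) = 1.
Proof. exact: Ex_cst. Qed.

Lemma pr_indep s D D' A B : depends_on D A -> depends_on D' B ->
    (forall e, D e -> D' e -> false) ->
  pr s (fun c => A c && B c) = pr s A * pr s B.
Proof.
move=> dA dB DD'; rewrite /pr -(@Ex_indep s D D') //; last 2 first.
- by move=> c c' /dA ->.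
- by move=> c c' /dB ->.
by apply: eq_Ex => c; rewrite -natrM mulnb.
Qed.

Lemma pr_harris s A B : decreasing A -> decreasing B ->
  pr s A * pr s B <= pr s (fun c => A c && B c).
Proof.
move=> dA dB.
have inc A' : decreasing A' -> increasing (fun c => -1 * (A' c)%:R).
  move=> dA' c c' /dA' AA; rewrite !mulN1r lerN2 ler_nat.
  by case: (A' c') AA => // ->.
have := Ex_harris s (inc _ dA) (inc _ dB); rewrite !ExZ !mulN1r mulrNN => h.
apply: le_trans h _; apply: le_Ex => c.
by rewrite !mulN1r mulrNN -natrM mulnb.
Qed.

Lemma pr_harris_all s (I : eqType) (r : seq I) (A : I -> (E -> bool) -> bool) (g : R) :
    0 <= g -> (forall i, i \in r -> decreasing (A i)) ->
    (forall i, i \in r -> g <= pr s (A i)) ->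
  g ^+ size r <= pr s (fun c => all (fun i => A i c) r).
Proof.
move=> g0; elim: r => [|i r IH] dA gA /=; first by rewrite expr0 prT.
rewrite exprS; apply: le_trans (pr_harris s _ _).
- apply: ler_pM => //; rewrite ?exprn_ge0 //.
    by apply: gA; rewrite mem_head.
  by apply: IH => j jr; [apply: dA|apply: gA]; rewrite inE jr orbT.
- by apply: dA; rewrite mem_head.
move=> c c' cc' /allP h; apply/allP => j jr; apply: (dA j) (h _ jr) => //.
by rewrite inE jr orbT.
Qed.

Lemma pr_mem s e : e \in s -> pr s (fun c => c e) = p.
Proof.
rewrite /pr; elim: s => //= e' s IH; rewrite inE => /orP[/eqP <-|es].
  rewrite (eq_Ex _ (G := fun=> 1)); last by move=> c; rewrite /upd eqxx.
  rewrite [X in _ + _ * X](eq_Ex _ (G := fun=> 0)); last by move=> c; rewrite /upd eqxx.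
  by rewrite !Ex_cst; ring.
rewrite /upd; case: (e == e').
  by rewrite !Ex_cst /= mulr1n mulr0n; ring.
by rewrite !IH //; ring.
Qed.

Lemma pr_notmem s e : e \notin s -> pr s (fun c => c e) = 0.
Proof.
rewrite /pr; elim: s => //= e' s IH; rewrite inE negb_or => /andP[/negPf ee' es].
by rewrite /upd ee' !IH //; ring.
Qed.

Lemma pr_le_p s e : pr s (fun c => c e) <= p.
Proof.
have [/pr_mem ->//|/pr_notmem ->] := boolP (e \in s).
by case/andP: p01.
Qed.

Lemma prC s A : pr s (fun c => ~~ A c) = 1 - pr s A.
Proof.
rewrite -[1 - pr s A]addrC -mulN1r /pr -ExZ -[X in _ + X](Ex_cst s) -ExD.
by apply: eq_Ex => c; case: (A c) => /=; ring.
Qed.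

(** Only an inequality, because [l] may repeat bonds; Harris' inequality makes it unnecessary to
    remove the repetitions. *)
Lemma pr_all_open s l : {subset l <= s} ->
  p ^+ size l <= pr s (fun c => all c l).
Proof.
case/andP: p01 => p0 p1; elim: l => [|e l IH] ls /=; first by rewrite expr0 prT.
have inc l' : increasing (fun c => (all c l')%:R).
  move=> c c' cc'; rewrite ler_nat; case: (boolP (all c l')) => // /allP h.
  by rewrite (introT allP) // => x /h /cc'.
have le_e := @Ex_harris s (fun c => (c e)%:R) (fun c => (all c l)%:R).
rewrite exprS -{1}(@pr_mem s e) ?ls ?mem_head //.
apply: le_trans (_ : pr s (fun c => c e) * pr s (fun c => all c l) <= _).
  apply: ler_wpM2l; first exact: pr_ge0.
  by apply: IH => x xl; rewrite ls // inE xl orbT.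
apply: le_trans (le_e _ (inc l)) _.
  by move=> c c' cc'; rewrite ler_nat; case: (c e) (cc' e) => // ->.
by apply: le_Ex => c; rewrite -natrM mulnb.
Qed.

Lemma pr_all_closed s l A : decreasing A ->
  (1 - p) ^+ size l * pr s A <= pr s (fun c => all (fun e => ~~ c e) l && A c).
Proof.
case/andP: p01 => p0 p1 dA; apply: le_trans (pr_harris s _ dA); last first.
  move=> c c' cc' /allP h; apply/allP => e /h; apply: contra; exact: cc'.
apply: ler_wpM2r; first exact: pr_ge0.
apply: (@pr_harris_all s E l (fun e c => ~~ c e)).
- by rewrite subr_ge0.
- by move=> e _ c c' cc'; apply: contra; apply: cc'.
by move=> e _; rewrite prC lerD2l lerN2 pr_le_p.
Qed.

(** The events are counted with weight 1 / probability, so the mean of the count N is their number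
    n. The Cauchy-Schwarz inequality is used in the form E (N - a 1)^2 >= 0, where 1 indicates that
    some event occurs. *)
Lemma pr_second_moment s (I : eqType) (r : seq I) (A : I -> (E -> bool) -> bool)
    (K : R) : (0 < size r)%N ->
    (forall i, i \in r -> 0 < pr s (A i)) ->
    \sum_(i <- r) \sum_(j <- r)
      pr s (fun c => A i c && A j c) / (pr s (A i) * pr s (A j)) <=
      K * (size r)%:R ^+ 2 ->
  1 <= K * pr s (fun c => has (fun i => A i c) r).
Proof.
move=> r0 A0 hK; set X := pr s _.
pose N c := \sum_(i <- r) (A i c)%:R / pr s (A i).
pose one c : R := (has (fun i => A i c) r)%:R.
have EN : Ex s N = (size r)%:R.
  rewrite Ex_sum -(count_predT r) -sum1_count natr_sum big_seq [RHS]big_seq.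
  apply: eq_bigr => i ir; rewrite (eq_Ex _ (G := fun c => (pr s (A i))^-1 * (A i c)%:R)).
    by rewrite ExZ mulVf // gt_eqF // A0.
  by move=> c; rewrite mulrC.
have EN2 : Ex s (fun c => N c ^+ 2) <= K * (size r)%:R ^+ 2.
  apply: le_trans hK; rewrite le_eqVlt; apply/orP; left; apply/eqP.
  rewrite (eq_Ex _ (G := fun c => \sum_(i <- r) \sum_(j <- r)
    (pr s (A i) * pr s (A j))^-1 * (A i c && A j c)%:R)).
    rewrite Ex_sum; apply: eq_bigr => i _; rewrite Ex_sum; apply: eq_bigr => j _.
    by rewrite ExZ mulrC.
  move=> c; rewrite expr2 /N mulr_suml; apply: eq_bigr => i _.
  rewrite mulr_sumr; apply: eq_bigr => j _.
  by rewrite -mulnb natrM invfM; ring.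
have N1 c : N c * one c = N c.
  rewrite /one; case: (boolP (has _ _)) => [|/hasPn h]; first by rewrite mulr1.
  rewrite mulr0 /N big_seq big1 // => i /h /negPf ->; exact: mul0r.
have one2 c : one c ^+ 2 = one c by rewrite /one; case: has; rewrite ?expr1n ?expr0n.
have key (a : R) : 0 <= Ex s (fun c => N c ^+ 2) - 2 * a * (size r)%:R + a ^+ 2 * X.
  rewrite -EN /X /pr -/one -[2 * a * _]opprK -mulNr opprK -!ExZ -!ExD.
  apply: Ex_ge0 => c; rewrite -/(one c).
  have -> : N c ^+ 2 + - (2 * a) * N c + a ^+ 2 * one c = (N c - a * one c) ^+ 2.
    by rewrite sqrrB exprMn one2 -{2}(N1 c); ring.
  exact: sqr_ge0.
have n0 : 0 < (size r)%:R :> R by rewrite ltr0n.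
(* With a = K n and E N^2 <= K n^2, the quadratic inequality becomes K n^2 (K X - 1) >= 0. *)
have := key (K * (size r)%:R).
move: EN2; set a := Ex s _; set n := (size r)%:R in n0 * => EN2 h.
have K0 : 0 < K.
  have h1 : 0 <= K * n ^+ 2.
    by apply: le_trans EN2; apply: Ex_ge0 => c; exact: sqr_ge0.
  rewrite lt_neqAle; apply/andP; split; last first.
    by move: h1; rewrite pmulr_lge0 // exprn_gt0.
  apply/eqP => K0; have := key 1; rewrite -/a -/n.
  have a0 : a <= 0 by move: EN2; rewrite -K0 mul0r.
  (* For K = 0 the second moment vanishes, and a = 1 / n gives 0 <= -2 + X / n^2 <= -1. *)
  have := key n^-1; have := key (2 * n^-1) ; rewrite -/a -/n.
  have X1 : X <= 1 by rewrite -(prT s); apply: le_pr.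
  have X0 : 0 <= X by exact: pr_ge0.
  have nn : n^-1 * n = 1 by rewrite mulVf // gt_eqF.
  rewrite -!mulrA nn => _ k _.
  have := k.
  have n1 : n^-1 <= 1.
    by rewrite invf_le1 // /n ler1n.
  have : n^-1 ^+ 2 * X <= 1.
    have -> : 1 = 1 * 1 :> R by rewrite mulr1.
    apply: ler_pM => //; first by rewrite exprn_ge0 // invr_ge0 ltW.
    by rewrite exprn_ile1 // invr_ge0 ltW.
  by rewrite mulr1; lra.
have : 0 <= K * n ^+ 2 * (K * X - 1).
  apply: le_trans h _; rewrite -subr_ge0.
  have -> : K * n ^+ 2 * (K * X - 1) - (a - 2 * (K * n) * n + (K * n) ^+ 2 * X)
    = K * n ^+ 2 - a by ring.
  by rewrite subr_ge0.
by rewrite pmulr_rge0 ?subr_ge0 // mulr_gt0 // exprn_gt0.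
Qed.

End BernoulliExpectation.

(** * Paths whose vertices have few open bonds *)

Section DegreeConstraint.
Variables (R : realFieldType) (E V : eqType) (Dir : finType) (ed : V -> Dir -> E).
Variables (p : R) (k : nat).
Hypothesis p01 : 0 < p < 1.

Let p01w : 0 <= p <= 1.
Proof. by case/andP: p01 => /ltW -> /ltW ->. Qed.

Implicit Types (c : E -> bool) (s l S : seq E).

Definition deg c v : nat := #|[pred a | c (ed v a)]|.

Definition low_deg V1 c := all (fun v => deg c v <= k)%N V1.

Definition good_path E1 V1 c := all c E1 && low_deg V1 c.

Lemma leq_deg c c' v : (forall a, c (ed v a) -> c' (ed v a)) -> (deg c v <= deg c' v)%N.
Proof. by move=> cc'; apply/subset_leq_card/fintype.subsetP => a; apply: cc'. Qed.

Lemma low_deg_imp V1 c c' : (forall v a, v \in V1 -> c' (ed v a) -> c (ed v a)) ->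
  low_deg V1 c -> low_deg V1 c'.
Proof.
move=> cc' /allP h; apply/allP => v vV; apply: leq_trans (h v vV).
by apply: leq_deg => a; apply: cc'.
Qed.

Lemma decreasing_low_deg V1 (f : (E -> bool) -> E -> bool) :
  (forall c c', (forall e, c e -> c' e) -> forall e, f c e -> f c' e) ->
  decreasing (fun c => low_deg V1 (f c)).
Proof. by move=> fi c c' cc'; apply: low_deg_imp => v a _; apply: fi. Qed.

(** Once [E1] is open, the degree condition reads only the bonds outside [E1], whence independence;
    the second factor is the probability of a decreasing event. *)
Lemma pr_good_path s (E1 : seq E) (V1 : seq V) :
  pr p s (good_path E1 V1) =
  pr p s (fun c => all c E1) * pr p s (fun c => low_deg V1 (fun e => (e \in E1) || c e)).
Proof.
rewrite -(@pr_indep _ _ _ s (mem E1) (predC (mem E1))).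
- apply: eq_pr => c; rewrite /good_path; apply: andb_id2l => /allP cE1.
  apply/idP/idP; apply: low_deg_imp => v a _ //=.
    by move=> /orP[/cE1|].
  by move=> ->; rewrite orbT.
- by move=> c c' cc'; apply: eq_in_all => e eE; apply: cc'.
- move=> c c' cc'; apply: eq_all => v; congr (_ <= _)%N; apply: eq_card => a.
  rewrite !inE; have [//|eE] := boolP (_ \in E1); apply: cc'; exact: eE.
- by move=> e /= ->.
Qed.

Lemma pr_good_path_gt0 s (E1 : seq E) (V1 : seq V) (g : R) : {subset E1 <= s} -> 0 < g ->
  (forall v, v \in V1 -> g <= pr p s (fun c => deg (fun e => (e \in E1) || c e) v <= k)%N) ->
  0 < pr p s (good_path E1 V1).
Proof.
move=> E1s g0 hg; case/andP: p01 => p0 p1; rewrite pr_good_path mulr_gt0 //.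
  by apply: lt_le_trans (pr_all_open p01w E1s); rewrite exprn_gt0.
apply: lt_le_trans (_ : g ^+ size V1 <= _); first by rewrite exprn_gt0.
rewrite /low_deg;
  apply: (@pr_harris_all _ _ _ p01w s _ _
    (fun v c => deg (fun e => (e \in E1) || c e) v <= k)%N) => //.
  exact: ltW.
move=> v _ c c' cc'; apply: leq_trans; apply: leq_deg => a.
by case: (_ \in E1) => //=; apply: cc'.
Qed.

(* The two paths are decoupled by closing the bonds S which join V1 to V2 \ V1;
   along the common part of the paths, Harris' inequality is used instead. *)
Lemma pr_good_path_pair s (E1 E2 : seq E) (V1 V2 : seq V) S (g : R) : {subset E2 <= s} -> 0 < g ->
  (forall v, v \in V2 -> g <= pr p s (fun c => deg (fun e => (e \in E2) || c e) v <= k)%N) ->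
  (forall v v' a a', v \in V1 -> v' \in V2 -> v != v' -> ed v a = ed v' a' -> ed v a \in S) ->
  pr p s (fun c => good_path E1 V1 c && good_path E2 V2 c) *
    (p ^+ count (mem E1) E2 * (1 - p) ^+ (size S).*2 * g ^+ count (mem V1) V2) <=
  pr p s (good_path E1 V1) * pr p s (good_path E2 V2).
Proof.
move=> E2s g0 hg hS; case/andP: p01 => p0 p1.
have q0 : 0 <= 1 - p by rewrite subr_ge0 ltW.
pose F2 := seq.filter (predC (mem E1)) E2.
pose W2 := seq.filter (predC (mem V1)) V2.
(* Both paths are forced open and [S] is forced closed, so that no random bond is seen both from
   [V1] and from [W2]. *)
pose cS (c : E -> bool) e := [|| e \in E1, e \in E2 | (e \notin S) && c e].
have cS_mono c c' : (forall e, c e -> c' e) -> forall e, cS c e -> cS c' e.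
  move=> cc' e; rewrite /cS; case: (_ \in E1) => //=; case: (_ \in E2) => //=.
  by case/andP => -> /cc'.
(* When both paths are open, passing to [cS] can only lower degrees, which gives an upper bound by a
   product. The next three steps bound the separate probabilities from below by the same factors. *)
have step1 : pr p s (fun c => good_path E1 V1 c && good_path E2 V2 c) <=
    pr p s (fun c => all c E1) * pr p s (fun c => all c F2) *
    (pr p s (fun c => low_deg V1 (cS c)) * pr p s (fun c => low_deg W2 (cS c))).
  pose D1 e := [&& e \notin E1, e \notin E2, e \notin S &
    has (fun v => [exists a, e == ed v a]) V1].
  pose D2 e := [&& e \notin E1, e \notin E2, e \notin S &
    has (fun v => [exists a, e == ed v a]) W2].
  have dS V' : depends_on (fun e => [&& e \notin E1, e \notin E2, e \notin S &
    has (fun v => [exists a, e == ed v a]) V']) (fun c => low_deg V' (cS c)).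
    move=> c c' cc'; apply: eq_in_all => v vV; congr (_ <= _)%N; apply: eq_card => a.
    rewrite !inE /cS.
    case: (boolP (_ \in E1)) => e1 //=; case: (boolP (_ \in E2)) => e2 //=.
    case: (boolP (_ \in S)) => eS //=; apply: cc'; rewrite e1 e2 eS /=.
    by apply/hasP; exists v => //; apply/existsP; exists a.
  have -> : pr p s (fun c => low_deg V1 (cS c)) * pr p s (fun c => low_deg W2 (cS c)) =
      pr p s (fun c => low_deg V1 (cS c) && low_deg W2 (cS c)).
    rewrite (@pr_indep _ _ p s D1 D2) //.
    - exact: dS.
    - exact: dS.
    move=> e; rewrite /D1 /D2 => /and4P[_ _ eS /hasP[v vV /existsP[a /eqP ea]]].
    move=> /and4P[_ _ _ /hasP[v']]; rewrite mem_filter /= => /andP[v'V1 v'V2].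
    move=> /existsP[a' /eqP ea']; move: eS; rewrite ea (hS v v' a a') //.
      by apply: contra v'V1 => /eqP <-.
    by rewrite -ea -ea'.
  have -> : pr p s (fun c => all c E1) * pr p s (fun c => all c F2) =
      pr p s (fun c => all c E1 && all c F2).
    rewrite (@pr_indep _ _ p s (mem E1) (mem F2)) //.
    - by move=> c c' cc'; apply: eq_in_all.
    - by move=> c c' cc'; apply: eq_in_all.
    - by move=> e /= eE1; rewrite mem_filter /= eE1.
  rewrite -(@pr_indep _ _ p s (fun e => (e \in E1) || (e \in E2))
    (fun e => (e \notin E1) && (e \notin E2))); last 3 first.
  - move=> c c' cc'; congr andb; apply: eq_in_all => e eE; apply: cc'.
      by rewrite eE.
    by move: eE; rewrite mem_filter => /andP[_ ->]; rewrite orbT.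
  - move=> c c' cc'; rewrite (dS V1 c c') 1?(dS W2 c c') // => e /and4P[e1 e2 _ _].
      by apply: cc'; rewrite e1 e2.
    by apply: cc'; rewrite e1 e2.
  - by move=> e /orP[->|->] //=; rewrite andbF.
  apply: le_pr => // c /andP[/andP[aE1 lV1] /andP[aE2 lV2]].
  have cSc e : cS c e -> c e.
    by case/or3P => [/(allP aE1)|/(allP aE2)|/andP[]].
  rewrite aE1 /=; apply/and3P; split.
  - by apply/allP => e; rewrite mem_filter => /andP[_ /(allP aE2)].
  - by apply: low_deg_imp lV1 => v a _; apply: cSc.
  - apply/allP => v; rewrite mem_filter => /andP[_ /(allP lV2) h]; apply: leq_trans h.
    by apply: leq_deg => a; apply: cSc.
(* A shared bond is paid once in the joint event and twice in the product: hence one factor [p] for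
   each. *)
have stepE : pr p s (fun c => all c F2) * p ^+ count (mem E1) E2 <=
    pr p s (fun c => all c E2).
  rewrite -size_filter; set G2 := seq.filter _ _.
  have -> : pr p s (fun c => all c E2) = pr p s (fun c => all c F2 && all c G2).
    apply: eq_pr => c; rewrite -all_cat; apply: eq_all_r => e.
    by rewrite mem_cat !mem_filter /=; case: (e \in E1); rewrite ?orbF.
  rewrite (@pr_indep _ _ p s (mem F2) (mem G2)); last 3 first.
  - by move=> c c' cc'; apply: eq_in_all.
  - by move=> c c' cc'; apply: eq_in_all.
  - by move=> e; rewrite /= !mem_filter /= => /andP[/negPf ->].
  apply: ler_wpM2l; first exact: pr_ge0.
  by apply: pr_all_open => // e; rewrite mem_filter => /andP[_ /E2s].
(* Used once for each path, which explains the doubled exponent of 1 - p. *)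
have stepS V' (E' : seq E) : (forall e, e \in E' -> (e \in E1) || (e \in E2)) ->
    (1 - p) ^+ size S * pr p s (fun c => low_deg V' (cS c)) <=
    pr p s (fun c => low_deg V' (fun e => (e \in E') || c e)).
  move=> E'E; apply: le_trans (pr_all_closed p01w s S _) _.
    exact: decreasing_low_deg.
  apply: le_pr => // c /andP[/allP cl]; apply: low_deg_imp => v a _.
  case/orP => [/E'E|ce]; rewrite /cS; first by case/orP => ->; rewrite ?orbT.
  have [/cl|_] := boolP (ed v a \in S); first by rewrite ce.
  by rewrite ce /= !orbT.
(* The vertices of [V2] dropped from [W2] are restored by Harris' inequality, at the price [g]
   each. *)
have stepV : pr p s (fun c => low_deg W2 (fun e => (e \in E2) || c e)) *
     g ^+ count (mem V1) V2 <=
    pr p s (fun c => low_deg V2 (fun e => (e \in E2) || c e)).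
  have fm c c' : (forall e, c e -> c' e) ->
      forall e, (e \in E2) || c e -> (e \in E2) || c' e.
    by move=> cc' e; case: (_ \in E2) => //=; apply: cc'.
  rewrite -size_filter; set X2 := seq.filter _ _.
  apply: le_trans (ler_wpM2l (pr_ge0 p01w _ _) (_ :
    _ <= pr p s (fun c => low_deg X2 (fun e => (e \in E2) || c e)))) _.
    apply: (@pr_harris_all _ _ _ p01w s _ _ (fun v c => deg (fun e => (e \in E2) || c e) v <= k)%N).
    - exact: ltW.
    - move=> v _ c c' cc'; apply: leq_trans; apply: leq_deg => a.
      exact: fm.
    - by move=> v; rewrite mem_filter => /andP[_ /hg].
  apply: le_trans (pr_harris p01w s _ _) _; try exact: decreasing_low_deg.
  apply: le_pr => // c /andP[/allP h1 /allP h2]; apply/allP => v vV2.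
  have [vV1|vV1] := boolP (v \in V1); first by apply: h2; rewrite mem_filter /= vV1.
  by apply: h1; rewrite mem_filter /= vV1.
rewrite !pr_good_path.
have s1 := stepS V1 E1 (fun e h => introT orP (or_introl h)).
have s2 := stepS W2 E2 (fun e h => introT orP (or_intror h)).
rewrite -addnn exprD.
set a := p ^+ _ in stepE *; set b := (1 - p) ^+ _ in s1 s2 *; set d := g ^+ _ in stepV *.
have a0 : 0 <= a by rewrite exprn_ge0 // ltW.
have b0 : 0 <= b by rewrite exprn_ge0.
have d0 : 0 <= d by rewrite exprn_ge0 // ltW.
apply: le_trans (ler_wpM2r _ step1) _; first by rewrite !mulr_ge0.
move: s1 s2 stepE stepV.
set x1 := pr p s (fun c => low_deg V1 (cS c)); set x2 := pr p s (fun c => low_deg W2 (cS c)).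
set y1 := pr p s _; set y2 := pr p s _; set y3 := pr p s _; set y4 := pr p s _; set y5 := pr p s _.
set y6 := pr p s _ => s1 s2 s3 s4.
have [x10 x20 y10 y20] : [/\ 0 <= x1, 0 <= x2, 0 <= y1 & 0 <= y2] by split; apply: pr_ge0.
have [y30 y40 y50 y60] : [/\ 0 <= y3, 0 <= y4, 0 <= y5 & 0 <= y6] by split; apply: pr_ge0.
have h2 : b * x2 * d <= y5 by apply: le_trans s4; apply: ler_wpM2r.
have -> : y6 * y3 * (x1 * x2) * (a * (b * b) * d) = y6 * (b * x1) * (y3 * a * (b * x2 * d)).
  by ring.
by apply: ler_pM; rewrite ?mulr_ge0 //; [apply: ler_wpM2l|apply: ler_pM; rewrite ?mulr_ge0].
Qed.

(** Markov's inequality for the number of open bonds at [v]; the bonds of [l] are added as if always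
    open. *)
Lemma pr_low_deg s l v (n : nat) : (#|[pred a | ed v a \in l]| + n <= k)%N ->
  1 - #|Dir|%:R * p / n.+1%:R <= pr p s (fun c => deg (fun e => (e \in l) || c e) v <= k)%N.
Proof.
move=> hk.
have E1 : pr p s (fun c => n < deg c v)%N * n.+1%:R <= #|Dir|%:R * p.
  rewrite mulrC /pr -ExZ;
    apply: le_trans (le_Ex p01w s (G := fun c => \sum_(a : Dir) (c (ed v a))%:R) _) _.
    move=> c; have [nd|_] := ltnP n (deg c v); last first.
      by rewrite mulr0; apply: sumr_ge0 => a _; rewrite ler0n.
    rewrite mulr1 -natr_sum ler_nat; apply: leq_trans nd _.
    by rewrite /deg -sum1_card big_mkcond /=; apply: leq_sum => a _; rewrite inE; case: ifP.
  rewrite Ex_sum; apply: le_trans (_ : \sum_(a : Dir) p <= _).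
    by apply: ler_sum => a _; apply: pr_le_p.
  by rewrite sumr_const mulr_natl.
rewrite -ler_pdivlMr ?ltr0n // in E1.
apply: le_trans (lerB (lexx 1) E1) _; rewrite -prC; apply: le_pr => // c.
rewrite -leqNgt => dn; apply: leq_trans hk; apply: leq_trans (leq_add (leqnn _) dn).
rewrite /deg -cardUI; apply: leq_trans (leq_addr _ _); apply/subset_leq_card/fintype.subsetP => a.
by rewrite !inE.
Qed.

End DegreeConstraint.

(** * Walks on the lattice *)

Section Lattice.
Variable d : nat.
Local Notation V := 'rV[int]_d.
Local Notation Dir := ('I_d * bool)%type.
Implicit Types (x y v u : V) (a : Dir) (w : seq Dir).

Definition step a : V := (if a.2 then 1 else -1) *: delta_mx 0 a.1.

Definition bond v a : {fset V} := [fset v; (v + step a)%R]%fset.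

Lemma stepE a j : step a 0 j = (if j == a.1 then if a.2 then 1 else -1 else 0).
Proof.
rewrite /step !mxE eqxx /= eq_sym; case: eqP => /= _; last by rewrite mulr0.
by rewrite mulr1.
Qed.

Lemma add_stepE x a j :
  (x + step a) 0 j = x 0 j + (if j == a.1 then if a.2 then 1 else -1 else 0).
Proof. by rewrite mxE stepE. Qed.

Lemma sub_rowE x y j : (x - y) 0 j = x 0 j - y 0 j.
Proof. by rewrite !mxE. Qed.

Lemma step_neq0 a : step a != 0.
Proof.
apply/eqP => /matrixP/(_ 0 a.1); rewrite stepE eqxx mxE; by case: a.2.
Qed.

Lemma step_inj : injective step.
Proof.
move=> [i b] [j b'] /matrixP/(_ 0 i); rewrite !stepE /= eqxx.
case: eqP => [->|_]; last by case: b.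
by case: b; case: b'.
Qed.

Lemma bondP v a u : reflect (u = v \/ u = v + step a) (u \in bond v a).
Proof. by rewrite in_fset2; apply: (iffP orP) => -[/eqP ?|/eqP ?]; auto. Qed.

Lemma bond_inj v : injective (bond v).
Proof.
move=> a a' e; have : v + step a \in bond v a' by rewrite -e; apply/bondP; right.
case/bondP => [/eqP|/addrI/step_inj //].
by rewrite -subr_eq0 addrC addKr (negPf (step_neq0 a)).
Qed.

Lemma latticeP v u : reflect (exists a, u = v + step a) (lattice_adj v u).
Proof.
apply: (iffP eqP) => [h|[a ->]]; last first.
  rewrite (bigD1 a.1) //= big1 ?addr0 => [|i ia]; rewrite mxE stepE.
    by rewrite eqxx opprD addNKr; case: a.2.
  by rewrite (negPf ia) addr0 subrr.
have [i vi|all0] := pickP (fun i => v 0 i != u 0 i); last first.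
  move: h; rewrite big1 // => i _.
  by move/negbFE: (all0 i) => /eqP ->; rewrite subrr normr0.
move: h; rewrite (bigD1 i) //= => h.
have s0 : 0 <= \sum_(j < d | j != i) `|v 0 j - u 0 j| by apply: sumr_ge0.
have n1 : 1 <= `|v 0 i - u 0 i| by rewrite -gtz0_ge1 normr_gt0 subr_eq0.
have [sE nE] : \sum_(j < d | j != i) `|v 0 j - u 0 j| = 0 /\ `|v 0 i - u 0 i| = 1.
  by move: h s0 n1; set s := \sum_(_ < _ | _) _; set n := Num.norm _; lia.
exists (i, v 0 i < u 0 i); apply/matrixP => k j; rewrite !ord1 mxE stepE /=.
case: eqP => [->|/eqP ji]; first by case: ltP; lia.
have := psumr_eq0P (fun (l : 'I_d) _ => normr_ge0 (v 0 l - u 0 l)) sE ji.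
by move/eqP; rewrite normr_eq0 subr_eq0 addr0 => /eqP.
Qed.

Lemma bond_bonds v a : bonds (@lattice_adj d) (bond v a).
Proof. by exists v, (v + step a); split=> //; apply/latticeP; exists a. Qed.

(** The starting vertex is left out, so that walks concatenate without repeating the junction. *)
Fixpoint walk x w : seq V := if w is a :: w' then (x + step a) :: walk (x + step a) w' else [::].

Fixpoint walk_bonds x w : seq {fset V} :=
  if w is a :: w' then bond x a :: walk_bonds (x + step a) w' else [::].

Definition endpoint x w : V := last x (walk x w).

Lemma size_walk x w : size (walk x w) = size w.
Proof. by elim: w x => //= a w IH x; rewrite IH. Qed.

Lemma size_walk_bonds x w : size (walk_bonds x w) = size w.
Proof. by elim: w x => //= a w IH x; rewrite IH. Qed.

Lemma walk_cat x w w' : walk x (w ++ w') = walk x w ++ walk (endpoint x w) w'.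
Proof. by elim: w x => //= a w IH x; rewrite IH. Qed.

Lemma walk_bonds_cat x w w' :
  walk_bonds x (w ++ w') = walk_bonds x w ++ walk_bonds (endpoint x w) w'.
Proof. by elim: w x => //= a w IH x; rewrite IH. Qed.

Lemma endpoint_cat x w w' : endpoint x (w ++ w') = endpoint (endpoint x w) w'.
Proof. by rewrite /endpoint walk_cat last_cat. Qed.

Lemma endpointE x w : endpoint x w = x + \sum_(a <- w) step a.
Proof.
elim: w x => [|a w IH] x; first by rewrite big_nil addr0.
by rewrite big_cons addrA -IH.
Qed.

Lemma mem_endpoint x w : endpoint x w \in x :: walk x w.
Proof. exact: mem_last. Qed.

Lemma walk_bondsP x w e : e \in walk_bonds x w ->
  exists2 v, v \in x :: walk x w & exists a, e = bond v a /\ v + step a \in walk x w.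
Proof.
elim: w x => //= a w IH x; rewrite inE => /orP[/eqP ->|/IH[v vw [a' [-> h]]]].
  by exists x; rewrite ?mem_head //; exists a; rewrite mem_head.
by exists v; [rewrite inE vw orbT|exists a'; rewrite inE h orbT].
Qed.

(** The degrees of two distinct vertices are correlated only through the bond that joins them; this
    is how the set [S] of bonds to close is recognised. *)
Lemma bond_common v v' a a' : v != v' -> bond v a = bond v' a' ->
  lattice_adj v v' /\ bond v a = [fset v; v']%fset.
Proof.
move=> vv' e; have : v' \in bond v a by rewrite e; apply/bondP; left.
case/bondP => [E|E]; first by rewrite E eqxx in vv'.
by rewrite /bond -E; split=> //; apply/latticeP; exists a.
Qed.

Lemma card_bond_in v (l : seq {fset V}) :
  (#|[pred a | bond v a \in l]| <= count (fun e : {fset V} => v \in e) l)%N.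
Proof.
rewrite -size_filter cardE -(size_map (bond v)); apply: uniq_leq_size.
  by rewrite map_inj_uniq ?enum_uniq //; apply: bond_inj.
move=> e /mapP[a]; rewrite mem_enum inE => al ->; rewrite mem_filter al andbT.
by apply/bondP; left.
Qed.

End Lattice.

(** * Blocks and their levels *)

Section TimeBlocks.
Variables (d m : nat).
Local Notation V := 'rV[int]_d.
Local Notation Dir := ('I_d * bool)%type.
Implicit Types (x y v u : V) (a : Dir) (w b : seq Dir) (bs : seq (seq Dir)).

(* The first m coordinates play the role of time: only they enter here. *)
Definition tsq v : int := \sum_(i < d | (i < m)%N) v 0 i ^+ 2.
Definition tdist x y : int := tsq (x - y).
Definition level v : int := \sum_(i < d | (i < m)%N) v 0 i.

Definition is_block b :=
  if b is a :: w then [&& (a.1 < m)%N, a.2 & all (fun a' => m <= a'.1)%N w] else false.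

Definition same_time x y := forall i : 'I_d, (i < m)%N -> x 0 i = y 0 i.

Lemma same_time_level x y : same_time x y -> level x = level y.
Proof. by move=> h; apply: eq_bigr => i /h. Qed.

Lemma same_time_tdist x x' y y' : same_time x y -> same_time x' y' ->
  tdist x x' = tdist y y'.
Proof. by move=> h h'; apply: eq_bigr => i im; rewrite !mxE h ?h'. Qed.

Lemma tsq_ge0 v : 0 <= tsq v.
Proof. by apply: sumr_ge0 => i _; apply: sqr_ge0. Qed.

Lemma tdist_eq0 x y : (tdist x y == 0) <-> same_time x y.
Proof.
split=> [/eqP h i im|h]; last first.
  apply/eqP/big1 => i im; rewrite !mxE h // subrr expr0n //.
have := psumr_eq0P (fun (j : 'I_d) _ => sqr_ge0 ((x - y) 0 j)) h im; move/eqP.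
by rewrite sqrf_eq0 !mxE subr_eq0 => /eqP.
Qed.

Lemma tsqD u v : tsq (u + v) <= 2 * tsq u + 2 * tsq v.
Proof.
rewrite /tsq !mulr_sumr -big_split /=; apply: ler_sum => i _; rewrite mxE -subr_ge0.
have -> : 2 * u 0 i ^+ 2 + 2 * v 0 i ^+ 2 - (u 0 i + v 0 i) ^+ 2 = (u 0 i - v 0 i) ^+ 2 by ring.
exact: sqr_ge0.
Qed.

Lemma tsqN u : tsq (- u) = tsq u.
Proof. by apply: eq_bigr => i _; rewrite mxE sqrrN. Qed.

Lemma tsq_step a : tsq (step a) <= 1.
Proof.
rewrite /tsq; apply: le_trans (_ : \sum_(i < d) (i == a.1)%:R <= _).
  rewrite big_mkcond /=; apply: ler_sum => i _; rewrite stepE.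
  by case: ifP => _ //; case: eqP => _ //; case: a.2.
by rewrite -natr_sum (bigD1 a.1) //= eqxx big1 // => i /negPf ->.
Qed.

Lemma level_step x a : level (x + step a) =
  level x + (if (a.1 < m)%N then if a.2 then 1 else -1 else 0).
Proof.
rewrite /level (eq_bigr (fun i => x 0 i + step a 0 i)); last by move=> i _; rewrite mxE.
rewrite big_split /=; congr (_ + _); case: ifP => am.
  rewrite (bigD1 a.1) //= stepE eqxx big1 ?addr0 // => i /andP[_ /negPf ia].
  by rewrite stepE ia.
by rewrite big1 // => i im; rewrite stepE; case: eqP => // ia; rewrite -ia im in am.
Qed.

Lemma level_adj v u : lattice_adj v u -> `|level v - level u| <= 1.
Proof. by case/latticeP => a ->; rewrite level_step; case: ifP => _; case: a.2; lia. Qed.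

Lemma level_adj_lt v u : lattice_adj v u ->
  (level u < level v + 2) /\ (level v < level u + 2).
Proof. by move/level_adj; lia. Qed.

Lemma walk_space x w v : all (fun a => m <= a.1)%N w -> v \in walk x w -> same_time v x.
Proof.
elim: w x => //= a w IH x /andP[am wm]; rewrite inE => h i im.
have st : (x + step a) 0 i = x 0 i.
  rewrite mxE stepE; case: eqP => [E|_]; last by rewrite addr0.
  by move: im; rewrite E ltnNge am.
by case/orP: h => [/eqP -> //|/(IH _ wm) ->].
Qed.

Lemma endpoint_space x w : all (fun a => m <= a.1)%N w -> same_time (endpoint x w) x.
Proof.
move=> wm i im; have := mem_endpoint x w; rewrite inE => /orP[/eqP -> //|].
by move/(walk_space wm); apply.
Qed.

Lemma walk_block x a w v : is_block (a :: w) -> v \in walk x (a :: w) ->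
  same_time v (x + step a).
Proof.
move=> /and3P[_ _ wm]; rewrite inE => /orP[/eqP -> //|]; exact: walk_space.
Qed.

Lemma endpoint_block x a w : is_block (a :: w) ->
  same_time (endpoint x (a :: w)) (x + step a).
Proof. by move=> /and3P[_ _ wm]; exact: (@endpoint_space (x + step a) w wm). Qed.

(** The time step comes first and the others do not change the level. As [walk] omits [x], a whole
    block sits at one level, and blocks of different index at different levels. *)
Lemma level_walk_block x b v : is_block b -> v \in walk x b -> level v = level x + 1.
Proof.
case: b => // a w bl /(walk_block bl)/same_time_level ->.
by case/and3P: bl => am a2 _; rewrite level_step am a2.
Qed.

Lemma level_endpoint x b : is_block b -> level (endpoint x b) = level x + 1.
Proof.
case: b => // a w bl; rewrite (same_time_level (endpoint_block x bl)).
by case/and3P: bl => am a2 _; rewrite level_step am a2.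
Qed.

Lemma level_walk x bs v : all is_block bs -> v \in walk x (flatten bs) ->
  level x + 1 <= level v.
Proof.
elim: bs x => //= b bs IH x /andP[bl bls]; rewrite walk_cat mem_cat.
case/orP => [/(level_walk_block bl) -> //|/(IH _ bls)].
by rewrite level_endpoint //; lia.
Qed.

Lemma level_walk_bonds_block x b e v : is_block b -> e \in walk_bonds x b -> v \in e ->
  level v <= level x + 1.
Proof.
move=> bl /walk_bondsP[u ux [a [-> ua]]] /bondP[->|->].
  move: ux; rewrite inE => /orP[/eqP -> |/(level_walk_block bl) ->]; lia.
by rewrite (level_walk_block bl ua).
Qed.

Lemma level_walk_bonds x bs e v : all is_block bs -> e \in walk_bonds x (flatten bs) ->
  v \in e -> level x <= level v.
Proof.
move=> bl /walk_bondsP[u ux [a [-> ua]]] /bondP[->|->].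
  move: ux; rewrite inE => /orP[/eqP -> //|/(level_walk bl)]; lia.
by have := level_walk bl ua; lia.
Qed.

Lemma level_walk_bonds_high x bs e : all is_block bs -> e \in walk_bonds x (flatten bs) ->
  exists2 v, v \in e & level x + 1 <= level v.
Proof.
move=> bl /walk_bondsP[u ux [a [-> ua]]]; exists (u + step a); first by apply/bondP; right.
exact: level_walk bl ua.
Qed.

Lemma count_eq0_in (T : eqType) (P : pred T) (s : seq T) :
  (forall t, t \in s -> ~~ P t) -> count P s = 0%N.
Proof. by move=> h; apply/eqP; rewrite -leqn0 leqNgt -has_count; apply/hasPn. Qed.

Lemma leq_count_in (T : eqType) (P Q : pred T) (s : seq T) :
  (forall t, t \in s -> P t -> Q t) -> (count P s <= count Q s)%N.
Proof.
move=> h; rewrite -!size_filter; elim: s h => //= t s IH h.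
have {}IH := IH (fun t' t's => h t' (@mem_behead _ (t :: s) t' t's)).
by case: (boolP (P t)) => [/(h t (mem_head _ _)) ->|_] //; case: ifP => _ //=; apply: leqW.
Qed.

Lemma count_walk_bonds x x' b b' bs bs' : level x = level x' ->
  is_block b -> is_block b' -> all is_block bs -> all is_block bs' ->
  (count (mem (walk_bonds x (flatten (b :: bs)))) (walk_bonds x' (flatten (b' :: bs'))) <=
   count (mem (walk_bonds x b)) (walk_bonds x' b') +
   count (mem (walk_bonds (endpoint x b) (flatten bs)))
     (walk_bonds (endpoint x' b') (flatten bs')))%N.
Proof.
move=> lx bl bl' bls bls'; rewrite /= !walk_bonds_cat count_cat; apply: leq_add.
  apply: leq_count_in => e eb'; rewrite /= mem_cat => /orP[//|].
  move=> /(level_walk_bonds_high bls)[v ve]; rewrite level_endpoint // lx.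
  by have := level_walk_bonds_block bl' eb' ve; lia.
apply: leq_count_in => e eb'; rewrite /= mem_cat => /orP[|//] eb.
have [v ve] := level_walk_bonds_high bls' eb'; rewrite level_endpoint //.
by have := level_walk_bonds_block bl eb ve; lia.
Qed.

(** Levels separate blocks of different index. Within one block all vertices have the time
    coordinates of the last one, so two blocks of equal index are disjoint unless these agree. *)
Lemma count_walk x x' b b' bs bs' : level x = level x' ->
  is_block b -> is_block b' -> all is_block bs -> all is_block bs' ->
  (count (mem (walk x (flatten (b :: bs)))) (walk x' (flatten (b' :: bs'))) <=
   (if tdist (endpoint x b) (endpoint x' b') == 0 then size b' else 0) +
   count (mem (walk (endpoint x b) (flatten bs)))
     (walk (endpoint x' b') (flatten bs')))%N.
Proof.
move=> lx bl bl' bls bls'; rewrite /= !walk_cat count_cat; apply: leq_add; last first.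
  apply: leq_count_in => v vb'; rewrite /= mem_cat => /orP[|//] vb.
  have := level_walk bls' vb'; rewrite level_endpoint //.
  by rewrite (level_walk_block bl vb); lia.
case: ifP => [_|/negbT td]; first by rewrite -(size_walk x' b') count_size.
rewrite leqn0; apply/eqP/count_eq0_in => v vb' /=; rewrite mem_cat negb_or.
apply/andP; split; last first.
  apply/negP => /(level_walk bls); rewrite level_endpoint //.
  by rewrite (level_walk_block bl' vb'); lia.
apply: contra td => vb; apply/tdist_eq0.
case: b bl vb => // a w bl vb; case: b' bl' vb' => // a' w' bl' vb'.
move=> i im; rewrite (endpoint_block _ bl im) (endpoint_block _ bl' im).
by rewrite -(walk_block bl vb im) -(walk_block bl' vb' im).
Qed.

(* X and Y are the vertices of the current blocks, which end at x and x'.  All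
   the bonds that can join the two paths are listed, and some pairs of vertices
   which are not adjacent. *)
Fixpoint links (X : seq V) x bs (Y : seq V) x' bs' : seq {fset V} :=
  match bs, bs' with
  | b :: bs1, b' :: bs1' =>
    (if tdist x x' <= 10 then
       [seq [fset v; v']%fset | v <- X ++ walk x b, v' <- Y ++ walk x' b']
     else [::]) ++
    links (walk x b) (endpoint x b) bs1 (walk x' b') (endpoint x' b') bs1'
  | _, _ => [::]
  end.

Lemma tdist_close x x' y y' v v' a a' : same_time y x \/ same_time y (x + step a) ->
  same_time y' x' \/ same_time y' (x' + step a') ->
  lattice_adj y y' -> tdist x x' <= 10.
Proof.
move=> hy hy' /latticeP[c yy'].
pose t (h : bool) (a0 : Dir) : V := if h then step a0 else 0.
have tE h a0 : tsq (t h a0) <= 1.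
  rewrite /t; case: h; first exact: tsq_step.
  by rewrite /tsq big1 // => i _; rewrite mxE expr0n.
have [h Eh] : exists h, same_time y (x + t h a).
  by case: hy => [?|?]; [exists false; rewrite /t addr0|exists true].
have [h' Eh'] : exists h, same_time y' (x' + t h a').
  by case: hy' => [?|?]; [exists false; rewrite /t addr0|exists true].
have -> : tdist x x' = tsq (- step c + (t h' a' + - t h a)).
  apply: eq_bigr => i im; have := Eh i im; have := Eh' i im.
  rewrite yy' !mxE => e1 e2; congr (_ ^+ 2); lra.
(* The constant 10: three vectors of square at most 1, combined by |u + v|^2 <= 2 |u|^2 + 2 |v|^2,
   give 2 + 2 (2 + 2). *)
have := tsqD (- step c) (t h' a' + - t h a); have := tsqD (t h' a') (- t h a).
by rewrite !tsqN; have := tE h a; have := tE h' a'; have := tsq_step c; lra.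
Qed.

(** Adjacent vertices differ by at most one level, hence lie in blocks of equal or consecutive
    index. Pairs from [X] and [Y] are excluded because they were listed one block earlier. *)
Lemma mem_links X x bs Y x' bs' v v' : size bs = size bs' ->
  all is_block bs -> all is_block bs' -> level x = level x' ->
  (forall u, u \in X -> same_time u x) -> (forall u, u \in Y -> same_time u x') ->
  v \in X ++ walk x (flatten bs) -> v' \in Y ++ walk x' (flatten bs') ->
  lattice_adj v v' -> ~~ ((v \in X) && (v' \in Y)) ->
  [fset v; v']%fset \in links X x bs Y x' bs'.
Proof.
elim: bs X x bs' Y x' => [|b bs IH] X x [|b' bs'] Y x' //=.
  by rewrite !cats0 => _ _ _ _ _ _ -> ->.
move=> [sz] /andP[bl bls] /andP[bl' bls'] lx hX hY.
rewrite !walk_cat !catA !(mem_cat _ (_ ++ _)) => hv hv' adj nXY.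
have [near|far] := boolP ((v \in X ++ walk x b) && (v' \in Y ++ walk x' b')).
  have [vX vY] := andP near.
  case: b bl hv near vX => // a w bl hv near vX;
    case: b' bl' hv' near vY => // a' w' bl' hv' near vY.
  have -> : tdist x x' <= 10.
    apply: (@tdist_close x x' v v' v v' a a') adj.
      by move: vX; rewrite mem_cat => /orP[/hX|/(walk_block bl)]; [left|right].
    by move: vY; rewrite mem_cat => /orP[/hY|/(walk_block bl')]; [left|right].
  by rewrite mem_cat; apply/orP; left; apply/allpairsP; exists (v, v').
have [ladj ladj'] := level_adj_lt adj.
have lX u : u \in X -> level u = level x by move/hX/same_time_level.
have lY u : u \in Y -> level u = level x' by move/hY/same_time_level.
have lW u : u \in walk (endpoint x b) (flatten bs) -> level x + 2 <= level u.
  by move/(level_walk bls); rewrite level_endpoint // -addrA.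
have lW' u : u \in walk (endpoint x' b') (flatten bs') -> level x' + 2 <= level u.
  by move/(level_walk bls'); rewrite level_endpoint // -addrA.
rewrite mem_cat; apply/orP; right; apply: IH => //.
- by rewrite !level_endpoint ?lx.
- move=> u uw i im; case: b bl {hv far lW} uw => // a w bl uw.
  by rewrite (walk_block bl uw im) (endpoint_block _ bl im).
- move=> u uw i im; case: b' bl' {hv' far lW'} uw => // a w bl' uw.
  by rewrite (walk_block bl' uw im) (endpoint_block _ bl' im).
- rewrite mem_cat; case/orP: hv => [|->]; last by rewrite orbT.
  rewrite mem_cat => /orP[vX|-> //]; case/orP: hv' => [h|/lW' h].
    by case/negP: far; rewrite h mem_cat vX.
  by move: h; rewrite -lx -(lX _ vX) leNgt ladj.
- rewrite mem_cat; case/orP: hv' => [|->]; last by rewrite orbT.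
  rewrite mem_cat => /orP[vY|-> //]; case/orP: hv => [h|/lW h].
    by case/negP: far; rewrite h mem_cat vY.
  by move: h; rewrite lx -(lY _ vY) leNgt ladj'.
by apply: contra far => /andP[v1 v2]; rewrite !mem_cat v1 v2 !orbT.
Qed.

(** By levels, [v] meets the bonds of at most two consecutive blocks. Such a crude bound is enough
    since [kappa] tends to infinity. *)
Lemma count_bonds_at x bs v L : all is_block bs -> all (fun b => size b == L) bs ->
  (count (fun e : {fset V} => v \in e) (walk_bonds x (flatten bs)) <= L.*2)%N.
Proof.
elim: bs x => //= b bs IH x /andP[bl bls] /andP[/eqP sb sbs].
have [lv|lv] := lerP (level v) (level x + 1); last first.
  rewrite walk_bonds_cat count_cat count_eq0_in ?IH // => e eb.
  by apply: contraL lv => ve; rewrite -leNgt; apply: level_walk_bonds_block bl eb ve.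
rewrite walk_bonds_cat count_cat -addnn; apply: leq_add.
  by rewrite -sb -(size_walk_bonds x b) count_size.
case: bs bls sbs {IH} => //= b2 bs /andP[bl2 bls] /andP[/eqP sb2 sbs].
rewrite walk_bonds_cat count_cat [X in (_ + X)%N]count_eq0_in.
  by rewrite addn0 -sb2 -(size_walk_bonds (endpoint x b) b2) count_size.
move=> e /(level_walk_bonds bls) h; apply/negP => /h.
by rewrite !level_endpoint //; lia.
Qed.

End TimeBlocks.

(** * Words in distinct spatial directions *)

Section Words.
Variables (d m : nat).
Local Notation V := 'rV[int]_d.
Local Notation Dir := ('I_d * bool)%type.
Implicit Types (x y v u : V) (a : Dir) (w b : seq Dir).

Definition fresh w : seq Dir :=
  [seq a : Dir <- enum {: Dir} | (m <= a.1)%N && (a.1 \notin map fst w)].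

(** Letters are added in front, each on a coordinate that no later letter uses; a coordinate once
    moved is therefore never moved back. *)
Fixpoint words l : seq (seq Dir) :=
  if l is l'.+1 then [seq a :: w | w <- words l', a <- fresh w] else [:: [::]].

Lemma wordsP l w : w \in words l ->
  [/\ size w = l, all (fun a : Dir => m <= a.1)%N w & uniq (map fst w)].
Proof.
elim: l w => [|l IH] w /=; first by rewrite inE => /eqP ->.
case/allpairsPdep => w' [a [/IH[sw mw uw]]].
rewrite mem_filter => /andP[/andP[am aw] _] -> /=.
by rewrite sw am mw aw uw.
Qed.

Lemma words_uniq l : uniq (words l).
Proof.
elim: l => //= l IH; apply: allpairs_uniq_dep => //.
  by move=> w _; apply: filter_uniq; apply: enum_uniq.
by move=> [w a] [w' a'] _ _ /= [-> ->].
Qed.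

Lemma size_fresh w : ((d - m - size w).*2 <= size (fresh w))%N.
Proof.
pose F := [pred j : 'I_d | (m <= j)%N && (j \notin map fst w)].
have -> : size (fresh w) = (#|F| * 2)%N.
  rewrite -[2%N]card_bool -cardX /fresh size_filter -sum1_count big_enum_cond /=.
  by rewrite -sum1_card; apply: eq_bigl => a; rewrite !inE andbT.
rewrite -muln2 leq_mul2r /=.
have hm : (d - m <= #|[pred j : 'I_d | (m <= j)%N]|)%N.
  rewrite -[X in (X - _)%N]card_ord -(cardC [pred j : 'I_d | (m <= j)%N]) leq_subLR.
  rewrite addnC leq_add2r cardE -(size_map val) -(size_iota 0 m).
  apply: uniq_leq_size; first by rewrite map_inj_uniq ?enum_uniq //; apply: val_inj.
  move=> j /mapP[i]; rewrite mem_enum inE -ltnNge => im ->.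
  by move: im; rewrite size_iota mem_iota.
rewrite leq_subLR; apply: leq_trans hm _.
rewrite -(cardID (mem (map fst w)) [pred j : 'I_d | (m <= j)%N]) leq_add //.
  apply: leq_trans (_ : #|map fst w| <= _)%N.
    by apply/subset_leq_card/fintype.subsetP => j; rewrite !inE => /andP[].
  by rewrite -(size_map fst); apply: card_size.
by apply/subset_leq_card/fintype.subsetP => j; rewrite !inE andbC.
Qed.

Lemma size_words l : ((d - m - l).*2 ^ l <= size (words l))%N.
Proof.
have H k : (k <= l)%N -> ((d - m - l).*2 ^ k <= size (words k))%N.
  elim: k => // k IH kl /=; rewrite size_allpairs_dep expnSr.
  apply: leq_trans (leq_mul (IH (ltnW kl)) (leqnn _)) _.
  rewrite sumnE big_map -sum1_size big_distrl /=.
  rewrite big_seq [X in (_ <= X)%N]big_seq; apply: leq_sum => w /wordsP[sw _ _].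
  rewrite mul1n; apply: leq_trans (size_fresh w); rewrite leq_double sw.
  by apply: leq_sub2l; apply: ltnW.
exact: H.
Qed.

Lemma sum_step_words w a : uniq (map fst w) -> a \in w ->
  (\sum_(c <- w) step c) 0 a.1 = if a.2 then 1 else -1.
Proof.
elim: w => //= c w IH /andP[cw uw]; rewrite inE big_cons mxE => /orP[/eqP ->|aw].
  rewrite stepE eqxx summxE big_seq big1 ?addr0 // => c' c'w; rewrite stepE.
  by case: eqP => // E; move: cw; rewrite E map_f.
rewrite (IH uw aw) stepE; case: eqP => [E|_]; last by rewrite add0r.
by move: cw; rewrite -E map_f.
Qed.

Lemma sum_step_words0 w (i : 'I_d) : i \notin map fst w -> (\sum_(c <- w) step c) 0 i = 0.
Proof.
move=> iw; rewrite summxE big_seq big1 // => c cw; rewrite stepE.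
by case: eqP => // E; move: iw; rewrite E map_f.
Qed.

(** The displacement shows which directions occur and with which sign; only their order is lost. At
    most l! words can therefore meet again at a given endpoint. *)
Lemma words_same_endpoint l x w w' : w \in words l -> w' \in words l ->
  endpoint x w = endpoint x w' -> w' \in permutations w.
Proof.
move=> /wordsP[sw _ uw] /wordsP[sw' _ uw']; rewrite !endpointE => /addrI E.
have uw2 := map_uniq uw; have uw2' := map_uniq uw'.
rewrite mem_permutations uniq_perm //.
have sub : {subset w' <= w}.
  move=> a aw'; have := sum_step_words uw' aw'; rewrite -E.
  have [/mapP[c cw ac]|/sum_step_words0 ->] := boolP (a.1 \in map fst w); last by case: a.2.
  rewrite ac (sum_step_words uw cw) => e.
  suff -> : a = c by [].
  move: ac e; case: a {aw'} => i s; case: c {cw} => j t /= -> .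
  by case: s; case: t.
by have [|_ //] := uniq_min_size uw2' sub; rewrite sw sw'.
Qed.

Lemma walk_bonds_avoid (x v : V) (i : 'I_d) w e : i \notin map fst w -> v 0 i != x 0 i ->
  e \in walk_bonds x w -> v \notin e.
Proof.
elim: w x => //= a w IH x; rewrite !inE negb_or => /andP[ia iw] vx.
have xa : (x + step a) 0 i = x 0 i by rewrite mxE stepE (negPf ia) addr0.
case/orP => [/eqP ->|]; last by apply: IH; rewrite ?xa.
apply/negP => /bondP[E|E]; first by rewrite E eqxx in vx.
by rewrite E xa eqxx in vx.
Qed.

(** Only the first bond of a word contains [x], which forces the first letters to agree. It follows
    that distinct words share at most l - 1 bonds. *)
Lemma words_same_bonds x w w' : size w = size w' ->
  uniq (map fst w) -> uniq (map fst w') ->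
  {subset walk_bonds x w' <= walk_bonds x w} -> w' = w.
Proof.
elim: w x w' => [|a w IH] x [|a' w'] //= [sz] /andP[aw uw] /andP[aw' uw'] sub.
have nx c w0 e : c.1 \notin map fst w0 -> e \in walk_bonds (x + step c) w0 -> x \notin e.
  move=> cw0; apply: walk_bonds_avoid cw0 _.
  by rewrite mxE stepE eqxx -subr_eq0 opprD addNKr oppr_eq0; case: c.2.
have xb c : x \in bond x c by apply/bondP; left.
have Ea : a' = a.
  have := sub _ (mem_head _ _); rewrite inE => /orP[/eqP/bond_inj //|].
  by move/(nx _ _ _ aw); rewrite xb.
congr (_ :: _) => //; apply: (IH (x + step a)) => // e ew'.
have := sub e; rewrite inE Ea ew' orbT inE => /(_ isT)/orP[/eqP E|//].
by move: (nx a' w' e aw'); rewrite Ea ew' E xb => /(_ isT).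
Qed.

(** Freshness is dropped, so each letter has 2d choices, of which at most [size E0] lead along a
    bond of [E0] and cost [P]. *)
Lemma sum_words_count (R : realFieldType) (P : R) (E0 : seq {fset V}) x l : 0 <= P ->
  \sum_(w <- words l) P ^+ count (mem E0) (walk_bonds x w) <=
  (d.*2%:R + (size E0)%:R * P) ^+ l.
Proof.
move=> P0; elim: l x => [|l IH] x /=; first by rewrite big_seq1 expr0.
rewrite big_allpairs_dep /=.
apply: le_trans (_ : \sum_(w <- words l) \sum_(a : Dir)
   P ^+ ((bond x a \in E0) + count (mem E0) (walk_bonds (x + step a) w)) <= _).
  apply: ler_sum => w _; rewrite big_filter -big_enum big_mkcond /=.
  by apply: ler_sum => a _; case: ifP => // _; apply: exprn_ge0.
rewrite exchange_big /= exprS.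
apply: le_trans (_ : \sum_(a : Dir) (1 + (bond x a \in E0)%:R * P) *
   (d.*2%:R + (size E0)%:R * P) ^+ l <= _).
  apply: ler_sum => a _.
  rewrite (eq_bigr (fun w => P ^+ (bond x a \in E0) *
    P ^+ count (mem E0) (walk_bonds (x + step a) w))); last by move=> w _; rewrite exprD.
  rewrite -mulr_sumr; apply: ler_pM (IH _) => //.
  - by rewrite exprn_ge0.
  - by apply: sumr_ge0 => w _; rewrite exprn_ge0.
  - by case: (_ \in E0); rewrite ?expr0 ?expr1 ?mul1r ?mul0r ?addr0 // lerDr.
rewrite -mulr_suml; apply: ler_wpM2r; first by rewrite exprn_ge0 // addr_ge0 ?mulr_ge0.
rewrite big_split /= sumr_const card_prod card_ord card_bool muln2 lerD2l.
rewrite -mulr_suml; apply: ler_wpM2r => //; rewrite -natr_sum ler_nat.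
rewrite -[X in (_ <= X)%N](@count_predT _ E0).
apply: leq_trans (_ : #|[pred a | bond x a \in E0]| <= _)%N.
  rewrite -sum1_card [X in (_ <= X)%N]big_mkcond /=; apply: leq_sum => a _.
  by rewrite inE; case: (_ \in E0).
by apply: leq_trans (card_bond_in _ _) _; rewrite count_predT count_size.
Qed.

(** Three cases: equal words; the at most l! reorderings, which share one bond fewer; and words with
    another endpoint, summed by [sum_words_count]. The missing factor [P] in the second case will
    compensate l!. *)
Lemma sum_words_merge (R : realFieldType) (P A B : R) x l w (H : V -> R) :
  (0 < l)%N -> 1 <= P -> 0 <= A -> 0 <= B -> w \in words l ->
  H (endpoint x w) <= A ->
  (forall w', w' \in words l -> endpoint x w' != endpoint x w -> H (endpoint x w') <= B) ->
  \sum_(w' <- words l) P ^+ count (mem (walk_bonds x w)) (walk_bonds x w') * H (endpoint x w') <=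
  P ^+ l * A + (l`!)%:R * (P ^+ l.-1 * A) + B * (d.*2%:R + l%:R * P) ^+ l.
Proof.
move=> l0 P1 A0 B0 wl HA HB; have P0 : 0 <= P by apply: le_trans P1.
have [sw _ uw] := wordsP wl.
apply: le_trans (_ : \sum_(w' <- words l) ((w' == w)%:R * (P ^+ l * A) +
   (w' \in permutations w)%:R * (P ^+ l.-1 * A) +
   B * P ^+ count (mem (walk_bonds x w)) (walk_bonds x w')) <= _).
  rewrite big_seq [leRHS]big_seq; apply: ler_sum => w' wl'.
  have [sw' _ uw'] := wordsP wl'.
  have PA k : 0 <= P ^+ k * A by rewrite mulr_ge0 // exprn_ge0.
  have BP k : 0 <= B * P ^+ k by rewrite mulr_ge0 // exprn_ge0.
  have cle : (count (mem (walk_bonds x w)) (walk_bonds x w') <= l)%N.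
    by apply: leq_trans (count_size _ _) _; rewrite size_walk_bonds sw'.
  have [E|E] := eqVneq (endpoint x w') (endpoint x w); last first.
    apply: le_trans (_ : _ <= B * P ^+ count (mem (walk_bonds x w)) (walk_bonds x w')) _.
      by rewrite mulrC; apply: ler_wpM2r; [rewrite exprn_ge0|apply: HB].
    by rewrite lerDr addr_ge0 // mulr_ge0.
  rewrite E; apply: le_trans (ler_wpM2l (exprn_ge0 _ P0) HA) _.
  apply: le_trans (_ : (w' == w)%:R * (P ^+ l * A) +
     (w' \in permutations w)%:R * (P ^+ l.-1 * A) <= _); last by rewrite lerDl.
  have [ww'|ww'] := eqVneq w' w.
    rewrite mul1r; apply: le_trans (_ : P ^+ l * A <= _); last by rewrite lerDl mulr_ge0.
    by apply: ler_wpM2r => //; apply: ler_weXn2l.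
  rewrite mul0r add0r (words_same_endpoint wl wl' (esym E)) mul1r.
  apply: ler_wpM2r => //; apply: ler_weXn2l => //; rewrite -ltnS prednK //.
  rewrite ltn_neqAle cle andbT; apply: contra ww' => /eqP cl; apply/eqP.
  apply: (@words_same_bonds x) => //; first by rewrite sw sw'.
  move=> e; apply/allP; rewrite all_count cl size_walk_bonds sw'; exact/eqP.
rewrite !big_split /= -!mulr_suml -mulr_sumr; apply: lerD; first apply: lerD.
- rewrite -[leRHS]mul1r; apply: ler_wpM2r; first by rewrite mulr_ge0 // exprn_ge0.
  rewrite -natr_sum -(big_mkcond (pred1 w) (fun=> 1%N)) /= sum1_count.
  by rewrite (count_uniq_mem w (words_uniq l)) wl.
- apply: ler_wpM2r; first by rewrite mulr_ge0 // exprn_ge0.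
  rewrite -natr_sum ler_nat -[in leqRHS]sw -(size_permutations (map_uniq uw)).
  apply: leq_trans (_ : size [seq w' <- words l | w' \in permutations w] <= _)%N.
    rewrite size_filter -sum1_count [leqRHS]big_mkcond /=.
    by apply: leq_sum => w' _; case: (_ \in _).
  apply: uniq_leq_size; first by rewrite filter_uniq // words_uniq.
  by move=> w'; rewrite mem_filter => /andP[].
apply: ler_wpM2l => //; have := sum_words_count (walk_bonds x w) x l P0.
by rewrite size_walk_bonds sw.
Qed.

End Words.

(** * Second moment of the number of paths *)

Section Superharmonic.
Variables (R : realFieldType) (I : finType) (T : pred I) (D : I -> R).

Let dsq (r : R) i j := r + 2 * (D i - D j) + 2 - 2 * (i == j)%:R.

(** The exact remainder is h^2 / (X^2 (X + h)), and X + h >= X / 2. *)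
Lemma invf_taylor2 (X h : R) : 0 < X -> - (X / 2) <= h ->
  (X + h)^-1 <= X^-1 - h / X ^+ 2 + 2 * h ^+ 2 / X ^+ 3.
Proof.
move=> X0 hX; have Xh : 0 < X + h by lra.
have -> : (X + h)^-1 = X^-1 - h / X ^+ 2 + h ^+ 2 / (X ^+ 2 * (X + h)).
  by field; rewrite !gt_eqF.
rewrite lerD2l ler_pdivrMr ?mulr_gt0 ?exprn_gt0 //.
have -> : 2 * h ^+ 2 / X ^+ 3 * (X ^+ 2 * (X + h)) = h ^+ 2 * (2 * (X + h) / X).
  by field; rewrite gt_eqF.
rewrite -[leLHS]mulr1; apply: ler_wpM2l; first exact: sqr_ge0.
by rewrite ler_pdivlMr //; lra.
Qed.

(* D is the difference of two walks, and dsq r i j the square of its norm after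
   the steps i and j. *)
Lemma sum_dsq_superharmonic (r : R) : (36 <= #|T|)%N ->
  \sum_(i | T i) D i ^+ 2 <= r ->
  \sum_(i | T i) \sum_(j | T j) (dsq r i j + 16)^-1 <=
  #|T|%:R ^+ 2 * ((r + 16)^-1 - (r + 16)^-1 ^+ 2).
Proof.
move=> T36 hr; set n := #|T|%:R : R; set X := r + 16.
have r0 : 0 <= r by apply: le_trans hr; apply: sumr_ge0 => i _; apply: sqr_ge0.
have X0 : 0 < X by rewrite /X; lra.
have Di i : T i -> D i ^+ 2 <= r.
  move=> Ti; apply: le_trans hr; rewrite (bigD1 i) //= lerDl.
  by apply: sumr_ge0 => j _; apply: sqr_ge0.
pose h i j := 2 * (D i - D j) + 2 - 2 * (i == j)%:R.
pose u i j := D i - D j.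
have hle i j : h i j ^+ 2 <= 4 * (u i j ^+ 2 + 2 * u i j + 1).
  rewrite /h /u; case: eqP => [->|_]; first by rewrite subrr expr0n /= !mulr0 mulr1; lra.
  by rewrite /= mulr0 subr0 le_eqVlt; apply/orP; left; apply/eqP; ring.
apply: le_trans (_ : \sum_(i | T i) \sum_(j | T j)
  (X^-1 - h i j / X ^+ 2 + 2 * (4 * (u i j ^+ 2 + 2 * u i j + 1)) / X ^+ 3) <= _).
  apply: ler_sum => i Ti; apply: ler_sum => j Tj.
  have -> : dsq r i j + 16 = X + h i j by rewrite /dsq /X /h; lra.
  apply: le_trans (invf_taylor2 X0 _) _.
    have uij : u i j ^+ 2 <= 4 * r.
      have := Di i Ti; have := Di j Tj; rewrite /u; have := sqr_ge0 (D i + D j); nra.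
    (* Yields h >= 2u >= -u^2 / 8 - 8 >= -r / 2 - 8 = -X / 2; the shift 16 makes this hold for every
       r. *)
    have : 0 <= (u i j + 8) ^+ 2 by apply: sqr_ge0.
    rewrite sqrrD /h -/(u i j) /X.
    by have [b0 b1] : 0 <= (i == j)%:R :> R /\ (i == j)%:R <= 1 :> R;
      [case: (i == j)|lra].
  rewrite lerD2l; apply: ler_wpM2r; last exact: ler_wpM2l.
  by rewrite invr_ge0 exprn_ge0 // ltW.
have sumc c : \sum_(i | T i) \sum_(j | T j) c = n ^+ 2 * c :> R.
  by rewrite sumr_const sumr_const -mulrnA -mulr_natl natrM expr2.
have sumu : \sum_(i | T i) \sum_(j | T j) u i j = 0.
  rewrite /u; under eq_bigr do rewrite sumrB.
  rewrite sumrB [X in _ - X]exchange_big /=; exact: subrr.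
have sumh : \sum_(i | T i) \sum_(j | T j) h i j = 2 * n ^+ 2 - 2 * n.
  transitivity (\sum_(i | T i) \sum_(j | T j) (2 * u i j + 2 - 2 * (i == j)%:R)) => //.
  under eq_bigr do rewrite sumrB big_split /= -!mulr_sumr.
  rewrite sumrB big_split /= -!mulr_sumr sumu mulr0 add0r.
  rewrite sumc; congr (_ - _); first by rewrite mulrC.
  congr (_ * _).
  rewrite (eq_bigr (fun=> 1)) ?sumr_const // => i Ti.
  by rewrite (bigD1 i) //= eqxx big1 ?addr0 // => j /andP[_ /negPf]; rewrite eq_sym => ->.
(* The mean of u^2 is at most 2r / n: in high dimension the second-order term, of size u^2 / X^3,
   stays below the gain due to the mean increase 2 - 2 / n of the squared norm. *)
have sumu2 : \sum_(i | T i) \sum_(j | T j) u i j ^+ 2 <= 2 * n * r.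
  have s2 : \sum_(i | T i) \sum_(j | T j) (D i * D j) = (\sum_(i | T i) D i) ^+ 2.
    by rewrite expr2 mulr_suml; apply: eq_bigr => i _; rewrite mulr_sumr.
  have -> : \sum_(i | T i) \sum_(j | T j) u i j ^+ 2 =
     2 * n * (\sum_(i | T i) D i ^+ 2) - 2 * (\sum_(i | T i) D i) ^+ 2.
    rewrite -s2.
    transitivity (\sum_(i | T i) \sum_(j | T j) (D i ^+ 2 + D j ^+ 2 - 2 * (D i * D j))).
      by apply: eq_bigr => i _; apply: eq_bigr => j _; rewrite /u; ring.
    under eq_bigr do rewrite sumrB big_split /=.
    rewrite sumrB big_split /=; congr (_ - _); last first.
      by rewrite mulr_sumr; apply: eq_bigr => i _; rewrite mulr_sumr.
    rewrite [X in _ + X]sumr_const; under eq_bigr do rewrite sumr_const.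
    by rewrite sumrMnl -mulr2n -[X in X *+ 2]mulr_natl -[LHS]mulr_natl mulrA.
  have n0 : 0 <= 2 * n by rewrite mulr_ge0 // ler0n.
  by have := ler_wpM2l n0 hr; have := sqr_ge0 (\sum_(i | T i) D i); lra.
have -> : \sum_(i | T i) \sum_(j | T j)
  (X^-1 - h i j / X ^+ 2 + 2 * (4 * (u i j ^+ 2 + 2 * u i j + 1)) / X ^+ 3) =
  n ^+ 2 / X - (2 * n ^+ 2 - 2 * n) / X ^+ 2 +
  8 / X ^+ 3 * (\sum_(i | T i) \sum_(j | T j) u i j ^+ 2 + n ^+ 2).
  transitivity (\sum_(i | T i) \sum_(j | T j)
    (X^-1 - X ^- 2 * h i j + (8 / X ^+ 3 * u i j ^+ 2 + 16 / X ^+ 3 * u i j + 8 / X ^+ 3))).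
    by apply: eq_bigr => i _; apply: eq_bigr => j _; ring.
  under eq_bigr do rewrite big_split /= sumrB !big_split /= -!mulr_sumr.
  rewrite big_split /= sumrB !big_split /= -!mulr_sumr sumu sumh !sumc.
  ring.
have n36 : 36 <= n by rewrite (ler_nat _ 36).
set U := \sum_(i | T i) _ in sumu2 *.
have -> : n ^+ 2 / X - (2 * n ^+ 2 - 2 * n) / X ^+ 2 + 8 / X ^+ 3 * (U + n ^+ 2) =
  n ^+ 2 * (X^-1 - X^-1 ^+ 2) - (n ^+ 2 - 2 * n - 8 * (U + n ^+ 2) / X) / X ^+ 2.
  by field; rewrite gt_eqF.
rewrite gerBl; apply: mulr_ge0; last by rewrite invr_ge0 exprn_ge0 // ltW.
suff : 8 * (U + n ^+ 2) / X <= n ^+ 2 - 2 * n by lra.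
have h1 : 0 <= r * n * (n - 36) by rewrite !mulr_ge0 ?subr_ge0 ?ler0n.
have h2 : 0 <= n * (n - 36) by rewrite mulr_ge0 ?subr_ge0 ?ler0n.
rewrite ler_pdivrMr // /X; apply: le_trans (_ : 8 * (2 * n * r + n ^+ 2) <= _).
  by rewrite ler_wpM2l // lerD2r.
rewrite -subr_ge0.
have -> : (n ^+ 2 - 2 * n) * (r + 16) - 8 * (2 * n * r + n ^+ 2) =
  r * n * (n - 36) + 18 * (r * n) + 8 * (n * (n - 36)) + 256 * n by ring.
by rewrite !addr_ge0 // mulr_ge0 // ?mulr_ge0 // ler0n.
Qed.

End Superharmonic.

(** * Drift of the Lyapunov function over one pair of blocks *)

Section OneStep.
Variables (R : realFieldType) (d m l : nat).
Local Notation V := 'rV[int]_d.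
Local Notation Dir := ('I_d * bool)%type.
Implicit Types (x y v u : V) (a : Dir) (w b : seq Dir) (i j : 'I_d).

Definition up i : Dir := (i, true).

Definition blocks : seq (seq Dir) :=
  [seq up i :: w | i <- [seq i : 'I_d <- enum 'I_d | (i < m)%N], w <- words d m l].

Lemma blocksP b : b \in blocks -> is_block m b /\ size b = l.+1.
Proof.
case/allpairsP => -[i w] /= [+ /wordsP[sw mw _] ->].
by rewrite mem_filter => /andP[im _] /=; rewrite im mw sw.
Qed.

Lemma card_time : (m <= d)%N -> #|[pred i : 'I_d | (i < m)%N]| = m.
Proof.
move=> md; rewrite -sum1_card -[RHS]card_ord -sum1_card (big_ord_widen d (fun=> 1%N) md).
by apply: eq_bigl.
Qed.

Lemma sum_blocks (F : seq Dir -> R) :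
  \sum_(b <- blocks) F b = \sum_(i < d | (i < m)%N) \sum_(w <- words d m l) F (up i :: w).
Proof. by rewrite /blocks big_allpairs_dep big_filter big_enum_cond. Qed.

Lemma size_blocks : (m <= d)%N -> size blocks = (m * size (words d m l))%N.
Proof.
by move=> md; rewrite size_allpairs size_filter -sum1_count big_enum_cond /= sum1_card card_time.
Qed.

Lemma tdist_up x x' i i' : (i < m)%N -> (i' < m)%N ->
  tdist m (x + step (up i)) (x' + step (up i')) =
  tdist m x x' + 2 * ((x 0 i - x' 0 i) - (x 0 i' - x' 0 i')) + 2 - 2 * (i == i')%:R.
Proof.
move=> im i'm; rewrite /tdist /tsq.
have pick (k : 'I_d) (f : 'I_d -> int) : (k < m)%N ->
    \sum_(j < d | (j < m)%N) f j * (j == k)%:R = f k.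
  move=> km; rewrite (bigD1 k) //= eqxx mulr1 big1 ?addr0 // => j /andP[_ /negPf ->].
  exact: mulr0.
transitivity (\sum_(j < d | (j < m)%N) ((x 0 j - x' 0 j) ^+ 2 +
  2 * ((x 0 j - x' 0 j) * (j == i)%:R - (x 0 j - x' 0 j) * (j == i')%:R) +
  (1 * (j == i)%:R + 1 * (j == i')%:R - 2 * ((j == i)%:R * (j == i')%:R)))).
  apply: eq_bigr => j jm; rewrite sub_rowE !add_stepE /=.
  by case: (j == i); case: (j == i') => /=; ring.
have -> : \sum_(j < d | (j < m)%N) (x - x') 0 j ^+ 2 =
    \sum_(j < d | (j < m)%N) (x 0 j - x' 0 j) ^+ 2.
  by apply: eq_bigr => j _; rewrite sub_rowE.
rewrite big_split big_split /= -[RHS]addrA; congr (_ + _).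
  by congr (_ + _); rewrite -mulr_sumr sumrB !pick.
rewrite sumrB big_split /= !(pick _ (fun=> 1)) // -mulr_sumr.
by rewrite (pick i' (fun j => (j == i)%:R)) // eq_sym; ring.
Qed.

Lemma walk_bonds_space x w e v : all (fun a : Dir => m <= a.1)%N w -> e \in walk_bonds x w ->
  v \in e -> same_time m v x.
Proof.
move=> mw /walk_bondsP[u uw [a [-> uaw]]] /bondP[->|->]; last exact: walk_space mw uaw.
by move: uw; rewrite inE => /orP[/eqP -> //|]; apply: walk_space.
Qed.

(** A time bond has an end at the lower level, which the other bonds avoid; so time bonds can
    coincide only with time bonds. *)
Lemma count_block x x' i i' w w' : level m x = level m x' -> (i < m)%N -> (i' < m)%N ->
  all (fun a : Dir => m <= a.1)%N w -> all (fun a : Dir => m <= a.1)%N w' ->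
  count (mem (walk_bonds x (up i :: w))) (walk_bonds x' (up i' :: w')) =
  ((x == x') && (i == i') +
   count (mem (walk_bonds (x + step (up i)) w)) (walk_bonds (x' + step (up i')) w'))%N.
Proof.
move=> lx im i'm mw mw'.
have lup (z : V) (k : 'I_d) : (k < m)%N -> level m (z + step (up k)) = level m z + 1.
  by move=> km; rewrite level_step /= km.
have hi (z : V) (k : 'I_d) w0 e v : (k < m)%N -> all (fun a : Dir => m <= a.1)%N w0 ->
    e \in walk_bonds (z + step (up k)) w0 -> v \in e -> level m v = level m z + 1.
  by move=> km mw0 ew ve; rewrite (same_time_level (walk_bonds_space mw0 ew ve)) lup.
have xb (z : V) c : z \in bond z c by apply/bondP; left.
rewrite /=; congr (_ + _)%N.
  congr nat_of_bool; rewrite inE; apply/idP/idP => [/orP[/eqP E|h]|/andP[/eqP -> /eqP ->]].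
  - have := xb x' (up i'); rewrite E => /bondP[X|X].
      by move: E; rewrite X => /bond_inj[->]; rewrite !eqxx.
    by move: (lup x i im); rewrite -X lx; lia.
  - by have := hi x i w _ x' im mw h (xb _ _); rewrite lx; lia.
  - by rewrite eqxx.
apply: eq_in_count => e ew' /=; rewrite inE; apply/orb_idl => /eqP E.
by have := hi x' i' w' e x i'm mw' ew'; rewrite E lx => /(_ (xb _ _)); lia.
Qed.

(** From equal times, only equal time steps lead to equal times: a fraction 1 / m of all pairs. *)
Lemma zero_pairs_same x x' : (m <= d)%N -> tdist m x x' = 0 ->
  (\sum_(i < d | (i < m)%N) \sum_(i' < d | (i' < m)%N)
     (tdist m (x + step (up i)) (x' + step (up i')) == 0) <= m)%N.
Proof.
move=> md r0; rewrite -[X in (_ <= X)%N](card_time md) -sum1_card; apply: leq_sum => i im.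
rewrite (bigD1 i) //= big1 ?addn0 ?leq_b1 // => i' /andP[i'm i'i].
have /eqP/tdist_eq0 st := r0.
by rewrite eq_sym in i'i; rewrite tdist_up // r0 !st // !subrr (negPf i'i).
Qed.

(** If the steps i and i' equalise the times, the time difference is e_i' - e_i, which determines
    both steps and is short. *)
Lemma zero_pairs_neq x x' : tdist m x x' != 0 ->
  (\sum_(i < d | (i < m)%N) \sum_(i' < d | (i' < m)%N)
     (tdist m (x + step (up i)) (x' + step (up i')) == 0) <= (tdist m x x' <= 10)%R)%N.
Proof.
move=> rn0.
have ends i i' : (i < m)%N -> (i' < m)%N ->
    tdist m (x + step (up i)) (x' + step (up i')) = 0 ->
    i != i' /\ forall j, (j < m)%N -> x 0 j - x' 0 j = (j == i')%:R - (j == i)%:R.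
  move=> im i'm /eqP/tdist_eq0 st; split; last first.
    move=> j jm; have := st j jm; rewrite !add_stepE /=.
    by case: (j == i); case: (j == i'); lia.
  apply: contra rn0 => /eqP ii'; apply/tdist_eq0 => j jm.
  by have := st j jm; rewrite ii' !add_stepE => /addIr.
have [/existsP[i /existsP[i' /and3P[im i'm /eqP E]]]|/existsPn h] :=
  boolP [exists i : 'I_d, [exists i' : 'I_d, [&& (i < m)%N, (i' < m)%N &
    tdist m (x + step (up i)) (x' + step (up i')) == 0]]]; last first.
  rewrite big1 // => i im; rewrite big1 // => i' i'm.
  by move: (h i) => /existsPn/(_ i'); rewrite im i'm /= => /negPf ->.
have [ii' hD] := ends _ _ im i'm E.
have -> : tdist m x x' <= 10.
  have -> : tdist m x x' = tsq m (step (up i') - step (up i)).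
    by apply: eq_bigr => j jm; rewrite !sub_rowE hD // !stepE /=; case: (j == i); case: (j == i').
  have := tsqD m (step (up i')) (- step (up i)); rewrite tsqN.
  by have := tsq_step m (up i); have := tsq_step m (up i'); lra.
rewrite (bigD1 i) //= (bigD1 i') //= [X in (_ + X + _)%N]big1; last first.
  move=> k' /andP[k'm k'i']; apply/eqP; rewrite eqb0; apply: contra k'i' => /eqP E'.
  have [ik' hD'] := ends _ _ im k'm E'; have := hD' _ i'm; rewrite hD // eqxx.
  by rewrite eq_sym (negPf ii') eq_sym; case: (k' == i').
rewrite [X in (_ + X)%N]big1 ?addn0 ?leq_b1 // => k /andP[km ki].
rewrite big1 // => k' k'm; apply/eqP; rewrite eqb0; apply: contra ki => /eqP E'.
have [kk' hD'] := ends _ _ km k'm E'; have := hD' _ km; rewrite hD // eqxx (negPf kk').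
by case: (k == i); case: (k == i').
Qed.

Variables (P lam mu A C CL : R).
Local Notation Wn := ((size (words d m l))%:R : R).
Local Notation M := (m%:R : R).

(** Price of a pair of blocks in the ratio of joint to separate probabilities: [lam] for closing the
    bonds that may join them, [mu] for the vertices and [P] for each bond that they share. *)
Definition wt x b x' b' : R :=
  (if tdist m x x' <= 10 then lam else 1) *
  (if tdist m (endpoint x b) (endpoint x' b') == 0 then mu else 1) *
  P ^+ count (mem (walk_bonds x b)) (walk_bonds x' b').

(* A bound for the total weight of the pairs of paths which start at x and x'. *)
Definition lyap x x' : R :=
  if x == x' then A else if tdist m x x' == 0 then 2 else 1 + C / ((tdist m x x')%:~R + 16).

Hypotheses (md : (m <= d)%N) (m36 : (36 <= m)%N) (l0 : (0 < l)%N).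
Hypotheses (P1 : 1 <= P) (lam1 : 1 <= lam) (mu1 : 1 <= mu) (A2 : 2 <= A) (C0 : 0 <= C) (C16 :
  C <= 16).
Hypothesis Wn0 : 0 < Wn.
Hypothesis count_le : (d.*2%:R + l%:R * P) ^+ l <= CL * Wn.
(** Here [f] is 1 / (r + 16) for a squared time distance 0 < r <= 10. The three drift conditions
    concern close pairs at different times, distinct vertices at equal times, and equal vertices. *)
Hypothesis close_le : forall f : R, 26^-1 <= f -> f <= 16^-1 ->
  lam * (1 + C * (f - f ^+ 2) + mu * A * CL / M ^+ 2) <= 1 + C * f.
Hypothesis meet_le : lam * (1 + C + mu * A * CL / M) <= 2.
Hypothesis merged_le : lam * (1 + C + mu * P *
  (P ^+ l * A + (l`!)%:R * (P ^+ l.-1 * A) + 2 * (CL * Wn)) / (M * Wn)) <= A.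

Let P0 : 0 <= P. Proof. exact: le_trans P1. Qed.
Let lam0 : 0 <= lam. Proof. exact: le_trans lam1. Qed.
Let mu0 : 0 <= mu. Proof. exact: le_trans mu1. Qed.
Let A0 : 0 <= A. Proof. by apply: le_trans A2. Qed.
Let M0 : 0 < M. Proof. by rewrite ltr0n; apply: leq_trans m36. Qed.

Lemma tdist_ge0 x x' : 0 <= tdist m x x'.
Proof. exact: tsq_ge0. Qed.

Lemma lyap_bounds x x' : 1 <= lyap x x' <= A.
Proof.
have a2 := A2; have c16 := C16.
rewrite /lyap; case: ifP => _; first by rewrite lexx andbT; lra.
case: ifP => _; first by rewrite A2 andbT; lra.
have r0 : 0 <= (tdist m x x')%:~R :> R by rewrite ler0z tdist_ge0.
have X0 : 0 < (tdist m x x')%:~R + 16 :> R by lra.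
rewrite lerDl (divr_ge0 C0 (ltW X0)) /=; apply: le_trans A2.
have : C / ((tdist m x x')%:~R + 16) <= 1 by rewrite ler_pdivrMr //; lra.
by lra.
Qed.

Lemma lyap_ge0 x x' : 0 <= lyap x x'.
Proof. by case/andP: (lyap_bounds x x') => h _; apply: le_trans h. Qed.

Let near x x' : R := if tdist m x x' <= 10 then lam else 1.

Let near_le x x' : 0 <= near x x' <= lam.
Proof. by rewrite /near; case: ifP => _; rewrite ?lexx ?lam0 ?lam1 ?ler01. Qed.

Let inner x x' i i' : R := \sum_(w <- words d m l) \sum_(w' <- words d m l)
  wt x (up i :: w) x' (up i' :: w') *
  lyap (endpoint x (up i :: w)) (endpoint x' (up i' :: w')).

Let sum_words_cst (c : R) : \sum_(w <- words d m l) c = Wn * c.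
Proof. by rewrite big_const_seq count_predT iter_addr_0 mulr_natl. Qed.

Let endpoint_up x i w : all (fun a : Dir => m <= a.1)%N w ->
  same_time m (endpoint x (up i :: w)) (x + step (up i)).
Proof. exact: (@endpoint_space _ _ (x + step (up i)) w). Qed.

(** Blocks at different times share no vertex and no bond, so the sum over words is explicit. *)
Lemma inner_far x x' i i' : level m x = level m x' -> (i < m)%N -> (i' < m)%N ->
  tdist m (x + step (up i)) (x' + step (up i')) != 0 ->
  inner x x' i i' = near x x' * Wn ^+ 2 *
    (1 + C / ((tdist m (x + step (up i)) (x' + step (up i')))%:~R + 16)).
Proof.
move=> lx im i'm td.
have td' : ~ same_time m (x + step (up i)) (x' + step (up i')).
  by move/tdist_eq0; apply/negP.
have -> : near x x' * Wn ^+ 2 *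
    (1 + C / ((tdist m (x + step (up i)) (x' + step (up i')))%:~R + 16)) =
  Wn * (Wn * (near x x' *
    (1 + C / ((tdist m (x + step (up i)) (x' + step (up i')))%:~R + 16)))) by ring.
rewrite -!sum_words_cst /inner big_seq [RHS]big_seq.
apply: eq_bigr => w /wordsP[_ mw _]; rewrite big_seq [RHS]big_seq.
apply: eq_bigr => w' /wordsP[_ mw' _].
have tdE := same_time_tdist (endpoint_up x i mw) (endpoint_up x' i' mw').
rewrite /wt /lyap tdE (negPf td) mulr1 -/(near x x') ifF; last first.
  apply/negP => /eqP E; apply: td' => k km.
  by rewrite -(endpoint_up x i mw km) E (endpoint_up x' i' mw' km).
rewrite count_block // (_ : _ && _ = false); last first.
  by apply/negP => /andP[/eqP E1 /eqP E2]; apply: td'; rewrite E1 E2.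
rewrite count_eq0_in ?expr0 ?mulr1 // => e ew' /=; apply/negP => ew.
have [v _ [a [E _]]] := walk_bondsP ew.
have ve : v \in e by rewrite E; apply/bondP; left.
apply: td' => k km; rewrite -(walk_bonds_space mw ew ve km).
exact: (walk_bonds_space mw' ew' ve km).
Qed.

(** All factors but the shared bonds are replaced by their maxima. This is affordable because it
    serves for at most m of the m^2 pairs of time steps. *)
Lemma inner_close x x' i i' : level m x = level m x' -> (i < m)%N -> (i' < m)%N ->
  x != x' -> inner x x' i i' <= lam * mu * (Wn * (A * (CL * Wn))).
Proof.
move=> lx im i'm xx'; rewrite /inner -sum_words_cst mulr_sumr.
rewrite big_seq [leRHS]big_seq; apply: ler_sum => w wl; have [sw mw _] := wordsP wl.
apply: le_trans (_ : \sum_(w' <- words d m l) lam * mu * (A *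
  P ^+ count (mem (walk_bonds (x + step (up i)) w)) (walk_bonds (x' + step (up i')) w')) <= _).
  rewrite big_seq [leRHS]big_seq; apply: ler_sum => w' /wordsP[_ mw' _].
  rewrite /wt count_block // (negPf xx') add0n.
  rewrite -mulrA [A * _]mulrC; apply: ler_pM.
  - by apply: mulr_ge0; case: ifP.
  - by rewrite mulr_ge0 ?exprn_ge0 ?lyap_ge0.
  - apply: ler_pM; by case: ifP => //; rewrite ?lexx.
  - by rewrite ler_wpM2l ?exprn_ge0 //;
    case/andP: (lyap_bounds (endpoint x (up i :: w)) (endpoint x' (up i' :: w'))).
rewrite -!mulr_sumr; apply: ler_wpM2l; first exact: mulr_ge0.
apply: ler_wpM2l => //; apply: le_trans count_le.
apply: le_trans (sum_words_count _ _ _ _ P0) _.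
by rewrite size_walk_bonds sw.
Qed.

(** Both blocks end at equal times, so [lyap] at their ends is [A] if they merge again and 2
    otherwise. *)
Lemma inner_same x i : (i < m)%N ->
  inner x x i i <= lam * mu * P * (Wn * (P ^+ l * A + (l`!)%:R * (P ^+ l.-1 * A) + 2 * (CL * Wn))).
Proof.
move=> im; rewrite /inner -sum_words_cst mulr_sumr.
rewrite big_seq [leRHS]big_seq; apply: ler_sum => w wl; have [sw mw _] := wordsP wl.
apply: le_trans (_ : lam * mu * P * \sum_(w' <- words d m l)
  P ^+ count (mem (walk_bonds (x + step (up i)) w)) (walk_bonds (x + step (up i)) w') *
  lyap (endpoint (x + step (up i)) w) (endpoint (x + step (up i)) w') <= _).
  rewrite mulr_sumr big_seq [leRHS]big_seq; apply: ler_sum => w' /wordsP[_ mw' _].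
  rewrite /wt count_block // !eqxx exprD expr1 /= !mulrA.
  apply: ler_wpM2r; first exact: lyap_ge0.
  apply: ler_wpM2r; first exact: exprn_ge0.
  apply: ler_wpM2r => //; apply: ler_pM; by case: ifP => // _; rewrite ?lexx.
apply: ler_wpM2l; first by rewrite !mulr_ge0.
apply: le_trans (sum_words_merge l0 P1 A0 (_ : 0 <= 2) wl _ _) _ => //.
- by rewrite /lyap eqxx.
- move=> w' wl' ww'; have [_ mw' _] := wordsP wl'.
  rewrite /lyap eq_sym (negPf ww') (_ : tdist m _ _ == 0) //.
  apply/tdist_eq0 => k km; rewrite (endpoint_space _ mw km).
  by rewrite (endpoint_space _ mw' km).
by rewrite lerD2l ler_wpM2l.
Qed.

Let D x x' i : R := (x 0 i - x' 0 i)%:~R.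

(** Superharmonicity handles the pairs of steps that keep the times apart; each pair that equalises
    them is charged [K]. *)
Let sum_inner_le x x' (K : R) : level m x = level m x' -> 0 <= K ->
  (forall i i', (i < m)%N -> (i' < m)%N ->
     tdist m (x + step (up i)) (x' + step (up i')) = 0 -> inner x x' i i' <= K) ->
  \sum_(i < d | (i < m)%N) \sum_(i' < d | (i' < m)%N) inner x x' i i' <=
  near x x' * Wn ^+ 2 * M ^+ 2 * (1 + C * (((tdist m x x')%:~R + 16)^-1 -
     ((tdist m x x')%:~R + 16)^-1 ^+ 2)) +
  K * (\sum_(i < d | (i < m)%N) \sum_(i' < d | (i' < m)%N)
     (tdist m (x + step (up i)) (x' + step (up i')) == 0))%:R.
Proof.
move=> lx K0 hK; set f := (_ + 16)^-1.
pose rr i i' : R := (tdist m (x + step (up i)) (x' + step (up i')))%:~R.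
have nr0 : 0 <= near x x' * Wn ^+ 2.
  by case/andP: (near_le x x') => n0 _; apply: mulr_ge0 => //; apply/exprn_ge0/ltW.
apply: le_trans (_ : \sum_(i < d | (i < m)%N) \sum_(i' < d | (i' < m)%N)
   (near x x' * Wn ^+ 2 * (1 + C * (rr i i' + 16)^-1) +
    K * (tdist m (x + step (up i)) (x' + step (up i')) == 0)%:R) <= _).
  apply: ler_sum => i im; apply: ler_sum => i' i'm.
  have X0 : 0 <= C * (rr i i' + 16)^-1.
    by rewrite mulr_ge0 // invr_ge0 addr_ge0 // ler0z tdist_ge0.
  have [E|E] := eqVneq (tdist m (x + step (up i)) (x' + step (up i'))) 0.
    rewrite mulr1; apply: le_trans (hK i i' im i'm E) _; rewrite lerDr.
    by rewrite mulr_ge0 // addr_ge0.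
  by rewrite inner_far // mulr0 addr0.
under eq_bigr do rewrite big_split /= -!mulr_sumr -natr_sum.
rewrite big_split /= -!mulr_sumr -natr_sum lerD2r -[leRHS]mulrA; apply: ler_wpM2l => //.
under eq_bigr do rewrite big_split /= -!mulr_sumr.
rewrite big_split /= -!mulr_sumr mulrDr mulr1; apply: lerD.
  by rewrite sumr_const sumr_const !card_time // -mulrnA natrM expr2.
rewrite mulrCA; apply: ler_wpM2l => //.
have := @sum_dsq_superharmonic R _ (fun i : 'I_d => (i < m)%N) (D x x') (tdist m x x')%:~R.
rewrite card_time // => /(_ m36) h; apply: le_trans (h _).
  apply: ler_sum => i im; apply: ler_sum => i' i'm.
  by rewrite /rr tdist_up // /D !(rmorphB, rmorphD, rmorphM, rmorph_nat).
rewrite /tdist /tsq raddf_sum /=; apply: ler_sum => i _.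
by rewrite !mxE rmorphXn.
Qed.

(** Supermartingale property of [lyap] for the weighted pair of walks, the source of uniformity in
    the number of blocks. *)
Lemma sum_wt_lyap x x' : level m x = level m x' ->
  \sum_(b <- blocks) \sum_(b' <- blocks)
    wt x b x' b' * lyap (endpoint x b) (endpoint x' b') <=
  (M * Wn) ^+ 2 * lyap x x'.
Proof.
move=> lx.
have -> : \sum_(b <- blocks) \sum_(b' <- blocks)
    wt x b x' b' * lyap (endpoint x b) (endpoint x' b') =
    \sum_(i < d | (i < m)%N) \sum_(i' < d | (i' < m)%N) inner x x' i i'.
  rewrite sum_blocks; apply: eq_bigr => i _; rewrite /inner [RHS]exchange_big /=.
  by apply: eq_bigr => w _; rewrite sum_blocks.
have W0 := ltW Wn0; have M0' := ltW M0; have Wn0' := Wn0; have M0'' := M0.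
have CL0 : 0 <= CL * Wn.
  by apply: le_trans count_le; rewrite exprn_ge0 // addr_ge0 // mulr_ge0.
set r := (tdist m x x')%:~R : R.
have r0 : 0 <= r by rewrite ler0z tdist_ge0.
have f16 : (r + 16)^-1 <= 16^-1 by rewrite lef_pV2 ?posrE; lra.
have f0 : 0 < (r + 16)^-1 by rewrite invr_gt0; lra.
have [hf0 hf1] : 0 <= (r + 16)^-1 - (r + 16)^-1 ^+ 2 /\ (r + 16)^-1 - (r + 16)^-1 ^+ 2 <= 1.
  move: f16 f0; set f := _^-1 => f16 f0; split; last by have := sqr_ge0 f; lra.
  have -> : f - f ^+ 2 = f * (1 - f) by ring.
  by apply: mulr_ge0; lra.
have nrM c : near x x' * Wn ^+ 2 * M ^+ 2 * c = (M * Wn) ^+ 2 * (near x x' * c) by ring.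
have MW0 : 0 <= (M * Wn) ^+ 2 by rewrite exprn_ge0 // mulr_ge0.
have [E|xx'] := eqVneq x x'.
  subst x'; have td0 : tdist m x x = 0 by apply/eqP/tdist_eq0.
  set K := lam * mu * P * (Wn * (P ^+ l * A + (l`!)%:R * (P ^+ l.-1 * A) + 2 * (CL * Wn))).
  have K0 : 0 <= K.
    apply: mulr_ge0; first by rewrite !mulr_ge0.
    apply: mulr_ge0 => //; apply: addr_ge0; last by apply: mulr_ge0.
    by rewrite addr_ge0 // !mulr_ge0 // exprn_ge0.
  apply: le_trans (sum_inner_le lx K0 _) _.
    move=> i i' im i'm; rewrite tdist_up // td0 !subrr.
    by case: (eqVneq i i') => [<- _|//]; apply: inner_same.
  have := zero_pairs_same md td0; rewrite -(ler_nat R) => /(ler_wpM2l K0) Z.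
  apply: le_trans (lerD (lexx _) Z) _; rewrite nrM -/r /lyap eqxx.
  apply: le_trans (ler_wpM2l MW0 merged_le).
  have -> : K * M = (M * Wn) ^+ 2 * (lam * (mu * P *
     (P ^+ l * A + (l`!)%:R * (P ^+ l.-1 * A) + 2 * (CL * Wn)) / (M * Wn))).
    by rewrite /K; field; rewrite !gt_eqF.
  rewrite -mulrDr; apply: ler_wpM2l => //; rewrite [leRHS]mulrDr lerD2r.
  have [nr0 nrl] := andP (near_le x x).
  by apply: ler_pM; rewrite ?addr_ge0 ?mulr_ge0 // lerD2l ler_piMr.
set K := lam * mu * (Wn * (A * (CL * Wn))).
have K0 : 0 <= K by do 2 (apply: mulr_ge0; first by rewrite ?mulr_ge0); apply: mulr_ge0.
have hK i i' : (i < m)%N -> (i' < m)%N ->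
    tdist m (x + step (up i)) (x' + step (up i')) = 0 -> inner x x' i i' <= K.
  by move=> im i'm _; apply: inner_close.
apply: le_trans (sum_inner_le lx K0 hK) _; rewrite nrM -/r.
have [td0|tdn0] := eqVneq (tdist m x x') 0.
  have := zero_pairs_same md td0; rewrite -(ler_nat R) => /(ler_wpM2l K0) Z.
  apply: le_trans (lerD (lexx _) Z) _; rewrite /lyap (negPf xx') td0 eqxx.
  apply: le_trans (ler_wpM2l MW0 meet_le).
  have -> : K * M = (M * Wn) ^+ 2 * (lam * (mu * A * CL / M)).
    by rewrite /K; field; rewrite !gt_eqF.
  rewrite -mulrDr; apply: ler_wpM2l => //; rewrite [leRHS]mulrDr lerD2r.
  have [nr0 nrl] := andP (near_le x x').
  by apply: ler_pM; rewrite ?addr_ge0 ?mulr_ge0 // lerD2l ler_piMr.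
have := zero_pairs_neq tdn0; rewrite -(ler_nat R) => /(ler_wpM2l K0) Z.
apply: le_trans (lerD (lexx _) Z) _; rewrite /lyap (negPf xx') (negPf tdn0) -/r /near.
(* Beyond squared distance 10 the weight [lam] is absent and no pair of steps equalises the times:
   superharmonicity suffices. *)
case: ifP => [r10|_]; last first.
  rewrite mulr0 addr0 mul1r; apply: ler_wpM2l => //; rewrite lerD2l ler_wpM2l //.
  by rewrite gerBl sqr_ge0.
rewrite mulr1; have -> : K = (M * Wn) ^+ 2 * (lam * (mu * A * CL / M ^+ 2)).
  by rewrite /K; field; rewrite !gt_eqF.
rewrite -mulrDr; apply: ler_wpM2l => //; rewrite -mulrDr; apply: close_le => //.
rewrite lef_pV2 ?posrE ?ltr0n //; last lra.
have : r <= 10 by rewrite /r (ler_int R _ 10).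
by lra.
Qed.

End OneStep.

(** * Iteration over the blocks and the second moment bound *)

Section BlockPaths.
Variables (R : realFieldType) (d m l : nat).
Local Notation V := 'rV[int]_d.
Local Notation Dir := ('I_d * bool)%type.
Implicit Types (x y v u : V) (a : Dir) (w b : seq Dir) (bs : seq (seq Dir)).
Local Notation blocks := (blocks d m l).

Fixpoint paths n : seq (seq (seq Dir)) :=
  if n is n'.+1 then [seq b :: bs | b <- blocks, bs <- paths n'] else [:: [::]].

Lemma pathsP n bs : bs \in paths n ->
  [/\ size bs = n, all (is_block m) bs & all (fun b => size b == l.+1) bs].
Proof.
elim: n bs => [|n IH] bs /=; first by rewrite inE => /eqP ->.
case/allpairsP => -[b bs'] /= [/blocksP[bl sb] /IH[sbs bls sbls] ->] /=.
by rewrite bl bls sb eqxx sbls sbs.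
Qed.

Lemma size_paths n : (m <= d)%N -> size (paths n) = ((m * size (words d m l)) ^ n)%N.
Proof. by move=> md; elim: n => //= n IH; rewrite size_allpairs IH size_blocks // expnS. Qed.

Section Weight.
Variables (P lam mu : R).

Fixpoint path_wt x bs x' bs' : R :=
  match bs, bs' with
  | b :: bs1, b' :: bs1' =>
    wt m P lam mu x b x' b' * path_wt (endpoint x b) bs1 (endpoint x' b') bs1'
  | _, _ => 1
  end.

(** Splits the price of a pair of paths block by block. Close blocks contribute at most (2 (l +
    1))^2 bonds to [links], paid twice, and blocks at equal times share at most l + 1 vertices. *)
Lemma path_wt_ge (Q G : R) X x bs Y x' bs' : 1 <= P -> 1 <= Q -> 1 <= G ->
  lam = Q ^+ ((l.+1).*2 ^ 2).*2 -> mu = G ^+ l.+1 ->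
  size bs = size bs' -> level m x = level m x' ->
  all (is_block m) bs -> all (is_block m) bs' ->
  all (fun b => size b == l.+1) bs -> all (fun b => size b == l.+1) bs' ->
  (size X <= l.+1)%N -> (size Y <= l.+1)%N ->
  P ^+ count (mem (walk_bonds x (flatten bs))) (walk_bonds x' (flatten bs')) *
  Q ^+ (size (links m X x bs Y x' bs')).*2 *
  G ^+ count (mem (walk x (flatten bs))) (walk x' (flatten bs')) <= path_wt x bs x' bs'.
Proof.
move=> P1 Q1 G1 lamE muE.
have [P0 Q0 G0] : [/\ 0 <= P, 0 <= Q & 0 <= G].
  by split; apply: le_trans ler01 _.
elim: bs X x bs' Y x' => [|b bs IH] X x [|b' bs'] Y x'.
  by rewrite /= !expr0 !mulr1.
1,2: by [].
rewrite ![size (_ :: _)]/= => -[sz] lx /andP[bl bls] /andP[bl' bls'] /andP[/eqP sb sbs]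
  /andP[/eqP sb' sbs'] sX sY.
rewrite [path_wt _ _ _ _]/=.
have lx' : level m (endpoint x b) = level m (endpoint x' b').
  by rewrite !level_endpoint // lx.
have {IH} := IH (walk x b) (endpoint x b) bs' (walk x' b') (endpoint x' b') sz lx' bls bls' sbs sbs'.
rewrite !size_walk sb sb' => /(_ (leqnn _) (leqnn _)) IH.
have cb := count_walk_bonds lx bl bl' bls bls'.
have cw := count_walk lx bl bl' bls bls'.
rewrite [links _ _ _ _ _ _ _]/=.
pose c1 := count (mem (walk_bonds x b)) (walk_bonds x' b').
pose c2 := count (mem (walk_bonds (endpoint x b) (flatten bs)))
  (walk_bonds (endpoint x' b') (flatten bs')).
pose c3 := count (mem (walk (endpoint x b) (flatten bs))) (walk (endpoint x' b') (flatten bs')).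
rewrite -/c1 -/c2 in cb; rewrite -/c3 in cw; rewrite -/c2 -/c3 in IH.
set L := links _ _ _ _ _ _ _ in IH *.
apply: le_trans (_ : wt m P lam mu x b x' b' * (P ^+ c2 * Q ^+ (size L).*2 * G ^+ c3) <= _);
  last first.
  apply: ler_wpM2l => //; rewrite /wt lamE muE !mulr_ge0 ?exprn_ge0 //; case: ifP => // _;
    exact: exprn_ge0.
rewrite /wt -/c1 lamE muE.
have regroup (z1 z2 z3 z4 z5 z6 : R) :
  z1 * z2 * z3 * (z4 * z5 * z6) = z3 * z4 * (z1 * z5) * (z2 * z6) by ring.
rewrite regroup.
have sE : (size (if (tdist m x x' <= 10)%R then
     [seq [fset v; v']%fset | v <- X ++ walk x b, v' <- Y ++ walk x' b'] else [::]) <=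
     if (tdist m x x' <= 10)%R then (l.+1).*2 ^ 2 else 0)%N.
  case: ifP => // _; rewrite size_allpairs !size_cat !size_walk sb sb' -mulnn -addnn.
  by rewrite leq_mul // leq_add.
apply: ler_pM; rewrite ?mulr_ge0 ?exprn_ge0 //.
- apply: ler_pM; rewrite ?exprn_ge0 //.
    by rewrite -exprD; apply: ler_weXn2l.
  rewrite size_cat doubleD exprD; apply: ler_wpM2r; first exact: exprn_ge0.
  move: sE; case: ifP => // _ sE; last by rewrite ler_weXn2l // leq_double.
- apply: le_trans (ler_weXn2l G1 cw) _; rewrite exprD; apply: ler_wpM2r; first exact: exprn_ge0.
  by case: ifP => // _; rewrite sb'.
Qed.

End Weight.

Section WeightSum.
Variables (P lam mu A C CL : R).
Local Notation Wn := ((size (words d m l))%:R : R).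
Local Notation M := (m%:R : R).
Hypotheses (md : (m <= d)%N) (m36 : (36 <= m)%N) (l0 : (0 < l)%N).
Hypotheses (P1 : 1 <= P) (lam1 : 1 <= lam) (mu1 : 1 <= mu) (A2 : 2 <= A) (C0 : 0 <= C) (C16 :
  C <= 16).
Hypothesis Wn0 : 0 < Wn.
Hypothesis count_le : (d.*2%:R + l%:R * P) ^+ l <= CL * Wn.
Hypothesis close_le : forall f : R, 26^-1 <= f -> f <= 16^-1 ->
  lam * (1 + C * (f - f ^+ 2) + mu * A * CL / M ^+ 2) <= 1 + C * f.
Hypothesis meet_le : lam * (1 + C + mu * A * CL / M) <= 2.
Hypothesis merged_le : lam * (1 + C + mu * P *
  (P ^+ l * A + (l`!)%:R * (P ^+ l.-1 * A) + 2 * (CL * Wn)) / (M * Wn)) <= A.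

Lemma sum_path_wt n x x' : level m x = level m x' ->
  \sum_(bs <- paths n) \sum_(bs' <- paths n) path_wt P lam mu x bs x' bs' <=
  (size (paths n))%:R ^+ 2 * lyap m A C x x'.
Proof.
elim: n x x' => [|n IH] x x' lx.
  rewrite /= !big_seq1 /= expr1n mul1r.
  by case/andP: (lyap_bounds m A2 C0 C16 x x').
rewrite [paths n.+1]/= big_allpairs_dep /=.
apply: le_trans (_ : \sum_(b <- blocks) \sum_(b' <- blocks)
  wt m P lam mu x b x' b' * ((size (paths n))%:R ^+ 2 *
    lyap m A C (endpoint x b) (endpoint x' b')) <= _).
  rewrite big_seq [leRHS]big_seq; apply: ler_sum => b bb.
  under eq_bigr do rewrite big_allpairs_dep /=.
  rewrite exchange_big /= big_seq [leRHS]big_seq; apply: ler_sum => b' bb'.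
  under eq_bigr do rewrite -mulr_sumr.
  rewrite -mulr_sumr; apply: ler_wpM2l; last first.
    by apply: IH; rewrite !level_endpoint ?lx //; [case/blocksP: bb'|case/blocksP: bb].
  have lam0 : 0 <= lam by apply: le_trans ler01 lam1.
  have mu0 : 0 <= mu by apply: le_trans ler01 mu1.
  have P0 : 0 <= P by apply: le_trans ler01 P1.
  rewrite /wt !mulr_ge0 ?exprn_ge0 //; by case: ifP.
apply: le_trans (_ : (size (paths n))%:R ^+ 2 * ((M * Wn) ^+ 2 * lyap m A C x x') <= _).
  have h := sum_wt_lyap md m36 l0 P1 lam1 mu1 A2 C0 C16 Wn0 count_le close_le meet_le merged_le lx.
  apply: le_trans (ler_wpM2l _ h); last exact: sqr_ge0.
  rewrite mulr_sumr; under [leRHS]eq_bigr do rewrite mulr_sumr.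
  by apply: ler_sum => b _; apply: ler_sum => b' _; rewrite mulrCA.
rewrite mulrA -exprMn size_allpairs size_blocks // !natrM.
by rewrite [_ * (M * Wn)]mulrC.
Qed.

Variables (p g : R) (kappa n0 : nat).
Hypotheses (p01 : 0 < p < 1) (g0 : 0 < g) (g1 : g <= 1).
Hypothesis PE : P = p^-1.
Hypothesis lamE : lam = (1 - p)^-1 ^+ ((l.+1).*2 ^ 2).*2.
Hypothesis muE : mu = g^-1 ^+ l.+1.
(** A vertex meets at most 2 (l + 1) bonds of the path, and [n0] further ones are tolerated. *)
Hypothesis kappaE : ((l.+1).*2 + n0 <= kappa)%N.
Hypothesis gE : g <= 1 - (d.*2)%:R * p / n0.+1%:R.

Definition good_block_path bs (c : {fset V} -> bool) : bool :=
  good_path (@bond d) kappa (walk_bonds 0 (flatten bs)) (0 :: walk 0 (flatten bs)) c.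

(** Second moment bound with K = A / g: both paths start at the origin, where [lyap] is [A], and 1 /
    g pays for the shared origin, which [walk] omits. *)
Lemma pr_has_good_block_path n (s : seq {fset V}) :
  (forall bs, bs \in paths n -> {subset walk_bonds 0 (flatten bs) <= s}) ->
  g <= A * pr p s (fun c => has (fun bs => good_block_path bs c) (paths n)).
Proof.
move=> hs; have p01w : 0 <= p <= 1 by case/andP: p01 => /ltW -> /ltW ->.
have [p0 p1] := andP p01.
have gpr bs : bs \in paths n -> forall v, g <= pr p s (fun c =>
    (deg (@bond d) (fun e => (e \in walk_bonds 0 (flatten bs)) || c e) v <= kappa)%N).
  move=> bsn v; have [_ bl sbl] := pathsP bsn; apply: le_trans gE _.
  rewrite -[d.*2]muln2 -{1}[d]card_ord -card_bool -card_prod.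
  apply: pr_low_deg => //; apply: leq_trans kappaE; rewrite leq_add2r.
  by apply: leq_trans (card_bond_in _ _) _; apply: count_bonds_at bl sbl.
have pos bs : bs \in paths n -> 0 < pr p s (good_block_path bs).
  by move=> bsn; apply: (@pr_good_path_gt0 _ _ _ _ _ _ _ p01 _ _ _ g) => //;
    [apply: hs|move=> v _; apply: gpr].
suff : 1 <= A / g * pr p s (fun c => has (fun bs => good_block_path bs c) (paths n)).
  by rewrite -mulrA mulrCA ler_pdivlMl // mulr1.
apply: pr_second_moment => //.
  rewrite size_paths // expn_gt0 muln_gt0 (leq_trans _ m36) //=.
  by rewrite -(ltr_nat R) Wn0.
have lyap0 : lyap m A C (0 : V) 0 = A by rewrite /lyap eqxx.
apply: le_trans (_ : \sum_(bs <- paths n) \sum_(bs' <- paths n)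
   g^-1 * path_wt P lam mu 0 bs 0 bs' <= _); last first.
  under eq_bigr do rewrite -mulr_sumr.
  have := sum_path_wt n (erefl (level m (0 : V))); rewrite lyap0 => h.
  rewrite -mulr_sumr [A / g]mulrC -mulrA [A * _]mulrC.
  by apply: ler_wpM2l h; rewrite invr_ge0 ltW.
rewrite big_seq [leRHS]big_seq; apply: ler_sum => bs bsn.
rewrite big_seq [leRHS]big_seq; apply: ler_sum => bs' bsn'.
have [sz bl sbl] := pathsP bsn; have [sz' bl' sbl'] := pathsP bsn'.
pose S := links m [:: 0] 0 bs [:: 0] 0 bs'.
have pair := @pr_good_path_pair R _ _ _ (@bond d) p kappa p01 s
  (walk_bonds 0 (flatten bs)) (walk_bonds 0 (flatten bs'))
  (0 :: walk 0 (flatten bs)) (0 :: walk 0 (flatten bs')) S g (hs _ bsn') g0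
  (fun v _ => gpr _ bsn' v).
set ov := count _ _ in pair; set sh := count _ _ in pair.
have q0 : 0 < 1 - p by rewrite subr_gt0.
set den := p ^+ ov * _ * _ in pair.
have den0 : 0 < den by rewrite !mulr_gt0 ?exprn_gt0.
have hden : den^-1 <= g^-1 * path_wt P lam mu 0 bs 0 bs'.
  apply: le_trans (_ : g^-1 * (P ^+ ov * (1 - p)^-1 ^+ (size S).*2 *
     g^-1 ^+ count (mem (walk 0 (flatten bs))) (walk 0 (flatten bs'))) <= _); last first.
    apply: ler_wpM2l; first by rewrite invr_ge0 ltW.
    apply: path_wt_ge => //; rewrite ?sz ?sz' //; first by rewrite invf_ge1 // gerBl ltW.
    by rewrite invf_ge1.
  rewrite /den !invfM PE -!exprVn mulrCA; apply: ler_wpM2l.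
    by rewrite mulr_ge0 // exprn_ge0 // invr_ge0 ltW.
  rewrite -exprS; apply: ler_weXn2l; first by rewrite invf_ge1.
  rewrite /sh /= -[X in (_ <= X)%N]add1n; apply: leq_add; first exact: leq_b1.
  apply: leq_count_in => v vb' /=; rewrite inE => /orP[/eqP v0|//].
  by have := level_walk bl' vb'; rewrite v0 gerDl.
apply: le_trans hden; rewrite ler_pdivrMr ?mulr_gt0 ?pos // mulrC ler_pdivlMr //.
apply: pair => v v' a a' vV vV' vv' E.
have [adj ->] := bond_common vv' E.
apply: (@mem_links _ _ [:: 0] 0 bs [:: 0] 0 bs') => //; rewrite ?sz ?sz' //.
- by move=> u; rewrite inE => /eqP ->.
- by move=> u; rewrite inE => /eqP ->.
by rewrite !inE; apply: contra vv' => /andP[/eqP -> /eqP ->].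
Qed.

End WeightSum.
End BlockPaths.

(** * Elementary inequalities *)

Lemma bernoulli_ge (R : realFieldType) (x : R) n : 0 <= x <= 1 -> 1 - n%:R * x <= (1 - x) ^+ n.
Proof.
case/andP => x0 x1; elim: n => [|n IH]; first by rewrite mul0r subr0 expr0.
rewrite exprS; apply: le_trans (_ : (1 - x) * (1 - n%:R * x) <= _); last first.
  by apply: ler_wpM2l => //; rewrite subr_ge0.
have h : 0 <= n%:R * x ^+ 2 by rewrite mulr_ge0 ?sqr_ge0.
by rewrite -natr1; lra.
Qed.

Lemma expr_inv_le (R : realFieldType) (x : R) n : 0 <= x -> x <= 2^-1 -> n%:R * x <= 2^-1 ->
  (1 - x)^-1 ^+ n <= 1 + 2 * n%:R * x.
Proof.
move=> x0 x1 nx.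
have x01 : 0 <= x <= 1 by rewrite x0 /=; apply: le_trans x1 _; lra.
have b := bernoulli_ge n x01; have q0 : 0 < 1 - x by lra.
have n0 : 0 <= n%:R * x by rewrite mulr_ge0.
rewrite exprVn -[_^-1]div1r ler_pdivrMr ?exprn_gt0 // -mulrA.
move: b nx n0; set z := n%:R * x => b nx n0.
apply: le_trans (_ : (1 + 2 * z) * (1 - z) <= _); last by apply: ler_wpM2l => //; lra.
have : 0 <= z * (1 - 2 * z) by apply: mulr_ge0; lra.
by lra.
Qed.

Lemma expr_ge_linear (R : realFieldType) (x : R) n : 0 <= x -> n%:R * x <= (1 + x) ^+ n.
Proof.
move=> x0; suff : 1 + n%:R * x <= (1 + x) ^+ n by lra.
elim: n => [|n IH]; first by rewrite mul0r addr0 expr0.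
rewrite exprS; apply: le_trans (_ : (1 + x) * (1 + n%:R * x) <= _); last first.
  by apply: ler_wpM2l => //; lra.
have h : 0 <= n%:R * x ^+ 2 by rewrite mulr_ge0 ?sqr_ge0.
by rewrite -natr1; lra.
Qed.

Section Numerics.
Variable R : realFieldType.

(** Here y is 1 / m. As 676 = 26^2 and f >= 1 / 26, the drift C1 y f^2 is at least (2c + 1) y, where
    2c y absorbs lam - 1 and y absorbs the meeting term K1 y^2. *)
Lemma close_step_bound (c C1 K1 y lam f : R) : 0 <= c -> 0 <= K1 -> 0 <= y -> y <= 1 ->
  C1 = 676 * (2 * c + 1) -> C1 * y <= 4^-1 -> K1 * y <= 4^-1 ->
  lam <= 1 + c * y -> 26^-1 <= f -> f <= 16^-1 ->
  lam * (1 + C1 * y * (f - f ^+ 2) + K1 * y ^+ 2) <= 1 + C1 * y * f.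
Proof.
move=> c0 K0 y0 y1 C1E Cy Ky hl f0 f1.
have C10 : 0 <= C1 by rewrite C1E; lra.
have ff0 : 0 <= f - f ^+ 2.
  have -> : f - f ^+ 2 = f * (1 - f) by ring.
  by apply: mulr_ge0; lra.
have ff1 : f - f ^+ 2 <= 1 by have := sqr_ge0 f; lra.
have Cy0 : 0 <= C1 * y by apply: mulr_ge0.
have Ky0 : 0 <= K1 * y ^+ 2 by rewrite mulr_ge0 // sqr_ge0.
have Ky2 : K1 * y ^+ 2 <= 4^-1.
  by rewrite expr2 mulrA; apply: le_trans Ky; rewrite ler_piMr // mulr_ge0.
have e0 : 0 <= 1 + C1 * y * (f - f ^+ 2) + K1 * y ^+ 2.
  by rewrite !addr_ge0 // mulr_ge0.
apply: le_trans (ler_wpM2r e0 hl) _.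
have h1 : C1 * y * (f - f ^+ 2) <= C1 * y by rewrite ler_piMr.
have cy0 : 0 <= c * y by rewrite mulr_ge0.
have h2 : c * y * (1 + C1 * y * (f - f ^+ 2) + K1 * y ^+ 2) <= c * y * 2.
  by apply: ler_wpM2l => //; lra.
have f2 : 676^-1 <= f ^+ 2.
  have -> : 676^-1 = 26^-1 ^+ 2 :> R by rewrite expr2; lra.
  by rewrite ler_sqr ?nnegrE //; lra.
have h3 : (2 * c + 1) * y <= C1 * y * f ^+ 2.
  have -> : (2 * c + 1) * y = C1 * y * 676^-1 by rewrite C1E; field.
  by apply: ler_wpM2l.
have h4 : K1 * y ^+ 2 <= y.
  by rewrite expr2 mulrA -[leRHS]mul1r; apply: ler_wpM2r => //; lra.
rewrite mulrDl mul1r mulrBr; rewrite mulrBr in h2; lra.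
Qed.

Lemma meet_step_bound (C K lam : R) : lam <= 5 / 4 -> 0 <= C -> C <= 4^-1 -> 0 <= K -> K <= 4^-1 ->
  lam * (1 + C + K) <= 2.
Proof.
move=> hl C0 C4 K0 K4; apply: le_trans (ler_wpM2r _ hl) _; first by lra.
by lra.
Qed.

(** The bound on [A] involves [A] itself, but with total coefficient t1 + t2 <= 1 / 4; hence A = 4 +
    4B is large enough. *)
Lemma merged_step_bound (C A B lam t1 t2 t3 : R) : lam <= 5 / 4 -> 0 <= C -> C <= 4^-1 -> 0 <= B ->
  A = 4 + 4 * B -> 0 <= t1 -> t1 <= 8^-1 -> 0 <= t2 -> t2 <= 8^-1 -> 0 <= t3 -> t3 <= B ->
  lam * (1 + C + (t1 * A + t2 * A + t3)) <= A.
Proof.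
move=> hl C0 C4 B0 AE t10 t11 t20 t21 t30 t31.
have A0 : 0 <= A by lra.
have h1 : t1 * A <= 8^-1 * A by apply: ler_wpM2r.
have h2 : t2 * A <= 8^-1 * A by apply: ler_wpM2r.
have h10 : 0 <= t1 * A by apply: mulr_ge0.
have h20 : 0 <= t2 * A by apply: mulr_ge0.
apply: le_trans (ler_wpM2r _ hl) _; first by lra.
by lra.
Qed.

End Numerics.

(** * Choice of the number of time directions and of the block length *)

Section ChoiceOfConstants.
Variable R : realType.

Lemma nat_above (x : R) : exists n : nat, x <= n%:R.
Proof.
by exists (Num.truncn x).+1; apply/ltW/truncnS_gt.
Qed.

(** That [c0] does not depend on [n] lets the number of blocks tend to infinity; that [K] and [D]
    depend on eps alone lets kappa and d grow at unrelated speeds. *)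
Lemma pr_has_good_block_path_ge (eps : R) : 0 < eps -> eps <= 1 ->
  exists (c0 : R) (K D : nat), 0 < c0 /\
  forall kappa d, (K <= kappa)%N -> (D <= d)%N ->
  let p := (1 + eps) / d.*2%:R in
  0 < p < 1 /\ exists m l : nat, (0 < m)%N /\ forall n s,
    (forall bs, bs \in paths d m l n -> {subset walk_bonds 0 (flatten bs) <= s}) ->
    c0 <= pr p s (fun c => has (fun bs => good_block_path kappa bs c) (paths d m l n)).
Proof.
move=> e0 e1.
have [q hq] := nat_above (16 / eps).
have q16 : 16 <= q%:R :> R.
  by apply: le_trans hq; rewrite ler_pdivlMr // ler_piMr.
have q0 : 0 < q%:R :> R by lra.
have qn0 : (0 < q)%N by rewrite -(ltr_nat R).
have hq2 : 2 / q%:R <= eps / 8.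
  rewrite ler_pdivrMr // mulrAC ler_pdivlMr //.
  by move: hq; rewrite ler_pdivrMr // mulrC; lra.
(* With m about d / q, the time directions and those already used in the word are at most a fraction
   2 / q of all. *)
pose al : R := 1 - 2 / q%:R.
have al0 : 1 - eps / 8 <= al by rewrite /al; lra.
have al1 : 0 < al by lra.
have al_le1 : al <= 1 by rewrite gerBl divr_ge0 // ltW.
pose g : R := 1 - eps / 8.
have g0 : 0 < g by rewrite /g; lra.
have g1 : g <= 1 by rewrite /g; lra.
(* After the loss [g] for the degrees and [al] for the directions, each spatial step still
   multiplies by more than 1. *)
have ega : 1 + eps / 2 <= (1 + eps) * g * al.
  apply: le_trans (_ : (1 + eps) * g * (1 - eps / 8) <= _); last first.
    by apply: ler_wpM2l => //; rewrite mulr_ge0 ?ltW //; lra.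
  have : 0 <= eps * (1 - eps) by apply: mulr_ge0; lra.
  have : 0 <= eps ^+ 3 by apply/exprn_ge0/ltW.
  rewrite /g.
  have -> : (1 + eps) * (1 - eps / 8) * (1 - eps / 8) =
    1 + eps * (3 / 4) - (15 / 64) * eps ^+ 2 + eps ^+ 3 / 64 by field.
  by rewrite mulrBr mulr1 -expr2; lra.
(* The time step has only about d / q choices instead of 2d. The growth over l steps must outweigh
   this; the factor 32 leaves the margin 1 / 8 of [t1le]. *)
have [l' hl'] := nat_above (32 * q%:R / (eps / 2)).
pose l := l'.+1.
have hl : 32 * q%:R <= (1 + eps / 2) ^+ l.
  apply: le_trans (expr_ge_linear _ _); last by lra.
  rewrite -ler_pdivrMr; last by lra.
  by apply: le_trans hl' _; rewrite ler_nat.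
(* Markov's inequality then gives 2dp / (n0 + 1) <= (1 + eps) eps / 16 <= eps / 8. *)
have [n0 hn0] := nat_above (16 / eps).
pose CL : R := ((1 + l%:R) / al) ^+ l.
have CL0 : 0 <= CL.
  by apply/exprn_ge0/divr_ge0; [rewrite addr_ge0|exact: ltW].
pose mu : R := g^-1 ^+ l.+1.
have mu1 : 1 <= mu by rewrite exprn_ege1 // invf_ge1.
have mu0 : 0 <= mu by lra.
pose N := (((l.+1).*2 ^ 2).*2)%N.
pose c : R := 2 * N%:R.
pose C1 : R := 676 * (2 * c + 1).
(* Bounds the contribution of blocks that share a time bond and end apart, using P / m <= 2d / m <=
   4q. *)
pose B : R := mu * (4 * q%:R) * (2 * CL).
have B0 : 0 <= B by rewrite /B; do 2?apply: mulr_ge0 => //; apply: mulr_ge0 => //; apply: mulr_ge0.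
pose A : R := 4 + 4 * B.
pose K1 : R := mu * A * CL.
have c0 : 0 <= c by apply: mulr_ge0.
have A0 : 0 <= A by rewrite /A addr_ge0 // mulr_ge0.
have K10 : 0 <= K1 by apply: mulr_ge0 => //; apply: mulr_ge0.
have C10 : 0 <= C1 by move: c0; rewrite /C1; clear; lra.
have [m0 hm0] := nat_above (36 + 4 * c + 4 * C1 + 4 * K1 + l%:R + (l`!)%:R).
exists (g / A), ((l.+1).*2 + n0)%N, (q * m0)%N; split.
  by rewrite divr_gt0 // /A ltr_pwDl // mulr_ge0.
move=> kappa d hk hd; set p := _ / _.
pose m := (d %/ q)%N.
have hm : (m0 <= m)%N by rewrite /m leq_divRL // mulnC.
have hmR : 36 + 4 * c + 4 * C1 + 4 * K1 + l%:R + (l`!)%:R <= m%:R :> R.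
  by apply: le_trans hm0 _; rewrite ler_nat.
have l0R : 0 <= l%:R :> R by rewrite ler0n.
have lf0 : 0 <= (l`!)%:R :> R by rewrite ler0n.
have [m36R lmR lfm] : [/\ 36 <= m%:R :> R, l%:R <= m%:R :> R & (l`!)%:R <= m%:R :> R].
  by move: hmR l0R lf0 c0 C10 K10; clear; split; lra.
have [cm C1m K1m] : [/\ 4 * c <= m%:R, 4 * C1 <= m%:R & 4 * K1 <= m%:R].
  by move: hmR l0R lf0 c0 C10 K10; clear; split; lra.
have m36 : (36 <= m)%N by rewrite -(ler_nat R).
have M0 : 0 < m%:R :> R by apply: lt_le_trans m36R.
have mqd : (m * q <= d)%N by apply: leq_trunc_div.
have dmq : (d <= 2 * (m * q))%N.
  have := ltn_ceil d qn0; rewrite -/m mulSn => h.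
  rewrite mul2n -addnn; apply: leq_trans (ltnW h) _; rewrite leq_add2r leq_pmull //.
  exact: leq_trans m36.
have md : (m <= d)%N by apply: leq_trans mqd; apply: leq_pmulr.
have mdR : m%:R <= d%:R :> R by rewrite ler_nat.
have d0 : 0 < d%:R :> R by apply: lt_le_trans mdR.
have d2 : d.*2%:R = 2 * d%:R :> R by rewrite -mul2n natrM.
have dd0 : 0 < d.*2%:R :> R by rewrite d2 mulr_gt0.
have pE : d.*2%:R * p = 1 + eps by rewrite /p mulrC divfK // gt_eqF.
have p0 : 0 < p by rewrite divr_gt0 // ltr_pwDl // ltW.
have pm : p <= m%:R^-1.
  rewrite /p ler_pdivrMr // mulrC ler_pdivlMr // d2.
  apply: le_trans (_ : 2 * m%:R <= _); last by rewrite ler_wpM2l.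
  by apply: ler_wpM2r; [exact: ltW|move: e1; clear; lra].
have y36 : m%:R^-1 <= 36^-1 :> R by rewrite lef_pV2 ?posrE //; lra.
have p1 : p < 1 by move: pm y36; clear; lra.
split; first by rewrite p0 p1.
exists m, l; split; first by rewrite (leq_trans _ m36).
move=> n s hs.
pose P : R := p^-1.
have P0 : 0 < P by rewrite invr_gt0.
have P1 : 1 <= P by rewrite invf_ge1 // ltW.
have PE : P = d.*2%:R / (1 + eps) by rewrite /P /p invf_div.
have Pd2 : P <= d.*2%:R.
  rewrite PE ler_pdivrMr; last by move: e0; clear; lra.
  by apply: ler_peMr; [exact: ltW|move: e0; clear; lra].
have Pd : d%:R <= P.
  rewrite PE ler_pdivlMr; last by move: e0; clear; lra.
  by rewrite d2 mulrC ler_wpM2r //; move: e1; clear; lra.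
set Wn : R := (size (words d m l))%:R.
have lm : (l <= m)%N by rewrite -(ler_nat R).
have hW : (d.*2%:R * al) ^+ l <= Wn.
  rewrite /Wn; apply: le_trans (_ : (((d - m - l).*2 ^ l)%N)%:R <= _); last first.
    by rewrite ler_nat size_words.
  rewrite natrX; apply: lerXn2r; rewrite ?nnegrE ?ler0n //.
    by rewrite mulr_ge0 // ltW.
  rewrite d2 -mul2n natrM -mulrA; apply: ler_wpM2l => //.
  have mlq : (m + l <= d)%N.
    apply: leq_trans mqd; apply: leq_trans (leq_add (leqnn m) lm) _.
    by rewrite addnn -mul2n mulnC leq_mul2l -(ler_nat R); apply/orP; right;
      apply: le_trans q16; clear; lra.
  rewrite -subnDA natrB // /al mulrBr mulr1 lerD2l lerN2 natrD.
  have h : m%:R * q%:R <= d%:R :> R by rewrite -natrM ler_nat.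
  rewrite mulrA ler_pdivlMr // mulrDl.
  have : l%:R * q%:R <= m%:R * q%:R :> R by rewrite ler_wpM2r // ltW.
  by move: h; clear; lra.
have X0 : 0 < (d.*2%:R * al) ^+ l by rewrite exprn_gt0 // mulr_gt0.
have Wn0 : 0 < Wn by apply: lt_le_trans hW.
have count_le : (d.*2%:R + l%:R * P) ^+ l <= CL * Wn.
  apply: le_trans (_ : (d.*2%:R * (1 + l%:R)) ^+ l <= _).
    apply: lerXn2r; rewrite ?nnegrE.
    - by rewrite addr_ge0 ?mulr_ge0 // ltW.
    - by rewrite mulr_ge0 ?addr_ge0.
    by rewrite mulrDr mulr1 lerD2l mulrC ler_wpM2r.
  apply: le_trans (ler_wpM2l CL0 hW); rewrite /CL -exprMn.
  by rewrite mulrCA divfK ?gt_eqF.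
pose lam : R := (1 - p)^-1 ^+ N.
have lam1 : 1 <= lam by rewrite exprn_ege1 // invf_ge1 ?subr_gt0 // gerBl ltW.
have y0 : 0 <= m%:R^-1 :> R by rewrite invr_ge0 ltW.
have cy : c * m%:R^-1 <= 4^-1 by move: cm; rewrite ler_pdivrMr //; clear; lra.
have C1y : C1 * m%:R^-1 <= 4^-1 by move: C1m; rewrite ler_pdivrMr //; clear; lra.
have K1y : K1 * m%:R^-1 <= 4^-1 by move: K1m; rewrite ler_pdivrMr //; clear; lra.
have cp : c * p <= c * m%:R^-1 by apply: ler_wpM2l.
have lamc : lam <= 1 + c * m%:R^-1.
  apply: le_trans (_ : 1 + 2 * N%:R * p <= _); last by rewrite lerD2l.
  apply: expr_inv_le; first exact: ltW.
  - by move: pm y36; clear; lra.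
  by move: cp cy; rewrite /c -(mulrA 2 N%:R p); clear; lra.
have lam54 : lam <= 5 / 4 by move: lamc cy; clear; lra.
have C1y0 : 0 <= C1 * m%:R^-1 by rewrite mulr_ge0.
(* The decisive estimate: the price of two identical blocks against the number of blocks, that is,
   supercritical growth per block. *)
have t1le : mu * P ^+ l.+1 / (m%:R * Wn) <= 8^-1.
  have MW : d%:R / (2 * q%:R) * (d.*2%:R * al) ^+ l <= m%:R * Wn.
    have dq0 : 0 <= d%:R / (2 * q%:R) :> R.
      by apply: divr_ge0; [exact: ltW|apply: mulr_ge0].
    apply: ler_pM dq0 (ltW X0) _ hW.
    by rewrite ler_pdivrMr ?mulr_gt0 // mulrCA -!natrM ler_nat.
  rewrite ler_pdivrMr ?mulr_gt0 //; apply: le_trans (ler_wpM2l _ MW); last by rewrite invr_ge0.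
  rewrite /mu PE -exprMn mulrCA exprMn.
  have eg : g^-1 / (1 + eps) = ((1 + eps) * g)^-1 by rewrite invfM mulrC.
  have eg1 : 1 <= (1 + eps) * g.
    apply: le_trans (_ : (1 + eps) * g * al <= _); first by move: e0 ega; clear; lra.
    by apply: ler_piMr => //; apply: mulr_ge0; [rewrite addr_ge0 // ltW|exact: ltW].
  have eg0 : 0 < (1 + eps) * g by apply: lt_le_trans eg1.
  have ea : (d.*2%:R * al) ^+ l = d.*2%:R ^+ l * al ^+ l by rewrite exprMn.
  rewrite eg ea exprS exprVn.
  have -> : 8^-1 * (d%:R / (2 * q%:R) * (d.*2%:R ^+ l * al ^+ l)) =
    d.*2%:R * d.*2%:R ^+ l * (al ^+ l / (32 * q%:R)).
    move: (d.*2%:R ^+ l) (al ^+ l) => z1 z2; rewrite d2.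
    by field; rewrite gt_eqF.
  apply: ler_wpM2l; first by rewrite mulr_ge0 ?exprn_ge0 // ltW.
  rewrite ler_pdivlMr ?mulr_gt0 // mulrC ler_pdivrMr ?exprn_gt0 //.
  apply: le_trans hl _; apply: le_trans (_ : ((1 + eps) * g * al) ^+ l <= _).
    apply: lerXn2r => //; rewrite nnegrE; first by move: e0; clear; lra.
    by apply: mulr_ge0; exact: ltW.
  rewrite exprMn mulrC; apply: ler_wpM2l; first by rewrite exprn_ge0 // ltW.
  by apply: ler_weXn2l.
have MW0 : 0 < m%:R * Wn by rewrite mulr_gt0.
have PX k : 0 <= P ^+ k by rewrite exprn_ge0 // ltW.
have t10 : 0 <= mu * P ^+ l.+1 / (m%:R * Wn).
  by apply: divr_ge0; [exact: mulr_ge0|exact: ltW].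
(* Reordered words share one bond fewer, and P >= d >= m >= l!, so this term is no larger than the
   previous one. *)
have t2E : mu * P * ((l`!)%:R * P ^+ l.-1) / (m%:R * Wn) =
    (l`!)%:R / P * (mu * P ^+ l.+1 / (m%:R * Wn)).
  by rewrite /l /= !exprS; field; rewrite !gt_eqF.
have lP : (l`!)%:R / P <= 1.
  by rewrite ler_pdivrMr // mul1r (le_trans lfm) // (le_trans mdR).
have lP0 : 0 <= (l`!)%:R / P by rewrite divr_ge0 // ltW.
have t3le : mu * P * (2 * (CL * Wn)) / (m%:R * Wn) <= B.
  have -> : mu * P * (2 * (CL * Wn)) / (m%:R * Wn) = mu * (P / m%:R) * (2 * CL).
    by field; rewrite !gt_eqF.
  rewrite /B; apply: ler_wpM2r; first by rewrite mulr_ge0.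
  apply: ler_wpM2l => //; rewrite ler_pdivrMr //; apply: le_trans Pd2 _; rewrite d2.
  have -> : 4 * q%:R * m%:R = 2 * (2 * (m%:R * q%:R)) :> R by ring.
  by apply: ler_wpM2l => //; rewrite -!natrM ler_nat.
have t30 : 0 <= mu * P * (2 * (CL * Wn)) / (m%:R * Wn).
  apply: divr_ge0; last exact: ltW.
  by apply: mulr_ge0; [apply: mulr_ge0 => //; exact: ltW|
    do 2![apply: mulr_ge0 => //]; exact: ltW].
have merged_le : lam * (1 + C1 * m%:R^-1 + mu * P *
    (P ^+ l * A + (l`!)%:R * (P ^+ l.-1 * A) + 2 * (CL * Wn)) / (m%:R * Wn)) <= A.
  have -> : mu * P * (P ^+ l * A + (l`!)%:R * (P ^+ l.-1 * A) + 2 * (CL * Wn)) / (m%:R * Wn) =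
    mu * P ^+ l.+1 / (m%:R * Wn) * A +
    mu * P * ((l`!)%:R * P ^+ l.-1) / (m%:R * Wn) * A +
    mu * P * (2 * (CL * Wn)) / (m%:R * Wn).
    by rewrite exprS; ring.
  apply: (@merged_step_bound R _ _ B) => //.
    by rewrite t2E mulr_ge0.
  rewrite t2E; apply: le_trans t1le; exact: ler_piMl.
have meet_le : lam * (1 + C1 * m%:R^-1 + mu * A * CL / m%:R) <= 2.
  by apply: meet_step_bound => //; apply: divr_ge0 => //; exact: ltW.
have close_le f : 26^-1 <= f -> f <= 16^-1 ->
    lam * (1 + C1 * m%:R^-1 * (f - f ^+ 2) + mu * A * CL / m%:R ^+ 2) <= 1 + C1 * m%:R^-1 * f.
  move=> f0 f1; rewrite -[_ / m%:R ^+ 2]/(_ * (m%:R ^+ 2)^-1) -exprVn.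
  apply: (@close_step_bound _ c) => //; by move: y36; clear; lra.
rewrite ler_pdivrMr; last by rewrite /A ltr_pwDl // mulr_ge0.
rewrite mulrC.
have A2 : 2 <= A by move: B0; rewrite /A; clear; lra.
have C1y16 : C1 * m%:R^-1 <= 16 by move: C1y; clear; lra.
apply: (pr_has_good_block_path md m36 (ltn0Sn l') P1 lam1 mu1 A2 C1y0 C1y16 Wn0 count_le
  close_le meet_le merged_le (p := p) (g := g) (n0 := n0)) => //; first by rewrite p0.
rewrite pE /g lerD2l lerN2 ler_pdivrMr //.
have h : 16 <= n0.+1%:R * eps.
  move: hn0; rewrite ler_pdivrMr // => hn0; apply: le_trans hn0 _.
  by rewrite ler_wpM2r ?ler_nat //; exact: ltW.
have -> : eps / 8 * n0.+1%:R = (n0.+1%:R * eps) / 8 by ring.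
by move: h e1; clear; lra.
Qed.

End ChoiceOfConstants.

Local Open Scope classical_set_scope.
Local Open Scope ring_scope.

Lemma pr_all_uniq (R : realFieldType) (E : eqType) (p : R) (s l : seq E) :
  uniq l -> {subset l <= s} -> pr p s (fun c => all c l) = p ^+ size l.
Proof.
elim: l => [|e l IH] /=; first by rewrite prT.
case/andP=> el ul ls; rewrite (@pr_indep _ _ p s (pred1 e) (mem l)).
- rewrite exprS pr_mem ?ls ?mem_head // IH // => x xl.
  by rewrite ls // inE xl orbT.
- by move=> c c' cc'; apply: cc'; apply/eqP.
- by move=> c c' cc'; apply: eq_in_all.
- by move=> x /= /eqP -> ; rewrite (negPf el).
Qed.

Lemma uniform_prob_le (R : realType) (t : R) : 0 <= t <= 1 ->
  uniform_prob (ltr01 : 0 < 1 :> R) `]-oo, t] = t%:E.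
Proof.
case/andP => t0 t1; rewrite /uniform_prob integral_uniform_pdf.
have -> : `]-oo, t] `&` `[0, 1] = `[0, t]%classic :> set R.
  apply/seteqP; split => x /=; rewrite !in_itv /=.
    by case=> xt /andP[-> _]; rewrite xt.
  by case/andP => -> xt; rewrite xt /= (le_trans xt).
rewrite (eq_integral (fun=> 1%:E)); last first.
  move=> x; rewrite inE /= in_itv /= => /andP[x0 xt].
  by rewrite /uniform_pdf x0 (le_trans xt) //= subr0 invr1.
rewrite integral_cst //= mul1e lebesgue_measure_itv /= lte_fin.
case: ltP => [_|t0']; first by rewrite oppr0 adde0.
by congr (_%:E); apply/eqP; rewrite eq_le t0 t0'.
Qed.

(** * The percolation process *)

Section Clocks.
Context (R : realType) (V : choiceType) (adj : rel V) (disp : measure_display)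
  (T : measurableType disp) (P : probability T R) (U : {fset V} -> {RV P >-> R}).
Variable t : R.
Implicit Types (s : seq {fset V}) (F : ({fset V} -> bool) -> bool).

Definition rung (w : T) : {fset V} -> bool := fun e => U e w <= t.

(** Follows the convention of [Ex]: bonds outside [s] are closed. *)
Definition restr s (c : {fset V} -> bool) : {fset V} -> bool := fun e => (e \in s) && c e.

Lemma restr_cons e s c : restr (e :: s) c = upd (restr s c) e (c e).
Proof.
apply/funext => x; rewrite /restr /upd inE; case: eqP => [->|_] //=.
Qed.

Lemma rung_preimage e : [set w | rung w e] = U e @^-1` `]-oo, t].
Proof. by apply/seteqP; split => w; rewrite /rung /= in_itv. Qed.

Lemma measurable_rung e : measurable [set w | rung w e].
Proof. by rewrite rung_preimage -[_ @^-1` _]setTI; apply: measurable_funP. Qed.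

Lemma split_rung e s F : [set w | F (restr (e :: s) (rung w))] =
  ([set w | rung w e] `&` [set w | F (upd (restr s (rung w)) e true)]) `|`
  (~` [set w | rung w e] `&` [set w | F (upd (restr s (rung w)) e false)]).
Proof.
apply/seteqP; split => w /=; rewrite restr_cons.
  by case: (boolP (rung w e)) => re Fw; [left|right; split => //; apply/negP].
by case=> [[-> //]|[/negP/negPf -> //]].
Qed.

Lemma measurable_restr s F : measurable [set w | F (restr s (rung w))].
Proof.
elim: s F => [|e s IH] F.
  have -> : [set w | F (restr [::] (rung w))] = if F (fun=> false) then setT else set0.
    by apply/seteqP; split => w /=; rewrite /restr /=; case: (F _).
  by case: ifP.
rewrite split_rung; apply: measurableU; apply: measurableI.
- exact: measurable_rung.
- exact: (IH (fun c => F (upd c e true))).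
- by apply: measurableC; apply: measurable_rung.
- exact: (IH (fun c => F (upd c e false))).
Qed.

Hypothesis iid : iid_uniform_clocks adj U.
Hypothesis t01 : 0 <= t <= 1.

Lemma prob_rung e : bonds adj e -> P (U e @^-1` `]-oo, t]) = t%:E.
Proof.
by move=> be; rewrite -(uniform_prob_le t01) -(iid.1 e be).
Qed.

(** Independence of the clocks is a product formula for finite cylinders. The induction moves the
    bonds of [s] into the cylinder one by one, as rung or not rung by time t. *)
Lemma prob_restr_cylinder s F (J : {fset {fset V}}) (B : {fset V} -> set R) :
  uniq s -> {in s, forall e, bonds adj e} -> {in s, forall e, e \notin J} ->
  [set` J] `<=` bonds adj -> (forall e, measurable (B e)) ->
  P (\bigcap_(e in [set` J]) (U e @^-1` B e) `&` [set w | F (restr s (rung w))]) =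
  (\prod_(e <- J) P (U e @^-1` B e) * (pr t s F)%:E)%E.
Proof.
elim: s F J B => [|e s IH] F J B.
  move=> _ _ _ Jb mB; rewrite -(iid.2 J B Jb mB) /pr /=.
  have -> : [set w | F (restr [::] (rung w))] = if F (fun=> false) then setT else set0.
    by apply/seteqP; split => w /=; rewrite /restr /=; case: (F _).
  by case: ifP => _; rewrite ?setIT ?mule1 // setI0 measure0 mule0.
move=> /= /andP[es us] sb sJ Jb mB.
have be : bonds adj e by apply: sb; rewrite mem_head.
have eJ : e \notin J by apply: sJ; rewrite mem_head.
have mBJ C : measurable C -> forall x, measurable (if x == e then C else B x).
  by move=> mC x; case: ifP.
have step C (G : ({fset V} -> bool) -> bool) : measurable C ->
    P (\bigcap_(x in [set` J]) (U x @^-1` B x) `&` (U e @^-1` C `&`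
      [set w | G (restr s (rung w))])) =
    (P (U e @^-1` C) * \prod_(x <- J) P (U x @^-1` B x) * (pr t s G)%:E)%E.
  move=> mC; have := IH G (e |` J)%fset (fun x => if x == e then C else B x) us.
  rewrite big_fsetU1 //= eqxx (eq_big_seq (fun x => P (U x @^-1` B x))); last first.
    by move=> x xJ /=; case: eqP => // xe; rewrite -xe xJ in eJ.
  move=> <- //; last 4 first.
  - by move=> x xs; apply: sb; rewrite inE xs orbT.
  - move=> x xs; rewrite in_fset1U negb_or sJ ?inE ?xs ?orbT // andbT.
    by apply: contra es => /eqP <-.
  - by move=> x /=; rewrite in_fset1U => /orP[/eqP ->|/Jb].
  - exact: mBJ.
  congr (P _); rewrite setIA; congr (_ `&` _); apply/seteqP; split => w /=.
    move=> [wJ wC] x /=; rewrite in_fset1U => /orP[/eqP ->|xJ]; first by rewrite eqxx.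
    by case: eqP => [->|_] //; apply: wJ.
  move=> h; split; last by have := h e; rewrite /= in_fset1U eqxx; apply.
  move=> x xJ; have := h x; rewrite /= in_fset1U xJ orbT => /(_ isT).
  by case: eqP => // xe; move: eJ; rewrite -xe => /negP; case/(_ xJ).
rewrite split_rung setIUr measureU; last 3 first.
- apply: measurableI; last first.
    by apply: measurableI;
      [exact: measurable_rung|exact: (measurable_restr s (fun c => F (upd c e true)))].
  apply: fin_bigcap_measurable => // x _; rewrite -[_ @^-1` _]setTI; exact: measurable_funP.
- apply: measurableI; last first.
    by apply: measurableI; [apply: measurableC;
      exact: measurable_rung|exact: (measurable_restr s (fun c => F (upd c e false)))].
  apply: fin_bigcap_measurable => // x _; rewrite -[_ @^-1` _]setTI; exact: measurable_funP.
- by rewrite -subset0 => w [[_ [re _]] [_ [nre _]]].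
have step1 := step `]-oo, t]%classic (fun c => F (upd c e true)) (measurable_itv _).
have step0 := step (~` `]-oo, t]%classic) (fun c => F (upd c e false))
  (measurableC (measurable_itv _)).
rewrite rung_preimage preimage_setC.
transitivity (P (U e @^-1` `]-oo, t]) * \prod_(x <- J) P (U x @^-1` B x) *
    (pr t s (fun c => F (upd c e true)))%:E +
  P (U e @^-1` (~` `]-oo, t]%classic)) * \prod_(x <- J) P (U x @^-1` B x) *
    (pr t s (fun c => F (upd c e false)))%:E)%E.
  by congr (_ + _)%E; [exact: step1|exact: step0].
rewrite -preimage_setC probability_setC; last first.
  by rewrite -rung_preimage; exact: measurable_rung.
rewrite prob_rung //.
have fin : (\prod_(x <- J) P (U x @^-1` B x))%E \is a fin_num.
  by rewrite -(iid.2 J B Jb mB); apply: fin_num_measure;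
    apply: fin_bigcap_measurable => // x _; rewrite -[_ @^-1` _]setTI; exact: measurable_funP.
rewrite -(fineK fin) /pr /= -EFinB -!EFinM -EFinD; congr (_%:E).
by rewrite /pr; ring.
Qed.

Lemma prob_restr s F : uniq s -> {in s, forall e, bonds adj e} ->
  P [set w | F (restr s (rung w))] = (pr t s F)%:E.
Proof.
move=> us sb; have := @prob_restr_cylinder s F fset0 (fun=> setT) us sb.
rewrite big_seq_fset0 mul1e => <- //.
by congr (P _); apply/seteqP; split => [w Fw|w [_ //]]; split.
Qed.

Lemma prob_all_rung l : uniq l -> {in l, forall e, bonds adj e} ->
  P [set w | all (rung w) l] = (t ^+ size l)%:E.
Proof.
move=> ul lb; rewrite -(@pr_all_uniq _ _ t l l) // -prob_restr //.
congr (P _); apply/seteqP; split => w /=;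
  by rewrite (@eq_in_all _ (rung w) (restr l (rung w))) // => e; rewrite /restr => ->.
Qed.

End Clocks.

(** * Infinite clusters and open self-avoiding walks *)

Section OpenWalks.
Variable d : nat.
Local Notation V := 'rV[int]_d.
Local Notation Dir := ('I_d * bool)%type.
Implicit Types (x y v u : V) (a : Dir) (w : seq Dir) (c : {fset V} -> bool).

Lemma path_walk c x (p : seq V) :
  path (fun u v => lattice_adj u v && c [fset u; v]%fset) x p <->
  exists w, walk x w = p /\ all c (walk_bonds x w).
Proof.
split.
  elim: p x => [|y p IH] x /=; first by exists [::].
  case/andP => /andP[/latticeP[a ->] cxy] /IH[w [wp cw]].
  by exists (a :: w) => /=; rewrite wp cxy cw.
case=> w [<-]; elim: w x => //= a w IH x /andP[ca /IH ->].
by rewrite -/(bond x a) ca !andbT; apply/latticeP; exists a.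
Qed.

Lemma connected_walk c x y : connected_by_open (@lattice_adj d) c x y <->
  exists w, all c (walk_bonds x w) /\ endpoint x w = y.
Proof.
split=> [[p [/path_walk[w [wp cw]] py]]|[w [cw wy]]].
  by exists w; rewrite /endpoint wp.
by exists (walk x w); split=> //; apply/path_walk; exists w.
Qed.

Lemma walk_take x w n : walk x (take n w) = take n (walk x w).
Proof. by elim: w x n => //= a w IH x [|n] //=; rewrite IH. Qed.

Lemma walk_bonds_take x w n : walk_bonds x (take n w) = take n (walk_bonds x w).
Proof. by elim: w x n => //= a w IH x [|n] //=; rewrite IH. Qed.

Lemma last_take (T : Type) (x : T) p i : (i <= size p)%N ->
  last x (take i p) = nth x (x :: p) i.
Proof.
elim: p x i => [|y p IH] x [|i] //= ip.
by rewrite IH //; apply: set_nth_default.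
Qed.

Lemma mem_walk_connected c x w v : all c (walk_bonds x w) -> v \in x :: walk x w ->
  connected_by_open (@lattice_adj d) c x v.
Proof.
move=> cw vw; apply/connected_walk; exists (take (index v (x :: walk x w)) w).
rewrite walk_bonds_take; split.
  by apply/allP => e /mem_take; apply/allP.
rewrite /endpoint walk_take; set i := index _ _.
have iw : (i <= size (walk x w))%N by have := vw; rewrite -index_mem.
by rewrite last_take // nth_index.
Qed.

Lemma walk_bonds_uniq x w : uniq (x :: walk x w) -> uniq (walk_bonds x w).
Proof.
elim: w x => //= a w IH x /andP[xw uw]; rewrite IH // andbT.
apply: contra xw => /walk_bondsP[u uwk [b [E ub]]].
have : x \in bond x a by apply/bondP; left.
rewrite E => /bondP[xE|xE]; first by rewrite {1}xE.
by rewrite {1}xE inE ub orbT.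
Qed.

Definition open_saw n c : bool :=
  [exists w : n.-tuple Dir, uniq (0 :: walk 0 w) && all c (walk_bonds 0 w)].

(** The walks of length less than n have finitely many endpoints, so an infinite cluster has a
    vertex outside them, and a loop-free open path to it has length at least n. The right side is
    also visibly measurable. *)
Lemma percolatesP c : percolates (@lattice_adj d) c 0 <-> forall n, open_saw n c.
Proof.
split=> [inf n|saw].
  pose ends k := [seq endpoint (0 : V) (tval z) | z <- enum {: k.-tuple Dir}].
  pose ball := flatten [seq ends k | k <- iota 0 n].
  have [x [cx xb]] : exists x, connected_by_open (@lattice_adj d) c 0 x /\ x \notin ball.
    apply: contrapT => h; apply: inf; apply: (sub_finite_set _ (finite_seq ball)) => x cx /=.
    by apply: contrapT => /negP xb; apply: h; exists x.
  case: cx => p [pp px]; move: px; case/shortenP: pp => p' pp' up' _ px.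
  have [w [wp cw]] := (path_walk _ _ _).1 pp'.
  have sw : (n <= size w)%N.
    rewrite leqNgt; apply: contra xb => wn; apply/flatten_mapP.
    exists (size w); first by rewrite mem_iota.
    apply/mapP; exists (in_tuple w); first by rewrite mem_enum.
    by rewrite -px -wp.
  apply/existsP; exists (tcast (size_takel sw) (in_tuple (take n w))).
  rewrite val_tcast /= walk_take walk_bonds_take; apply/andP; split.
    have : uniq (take n.+1 (0 :: walk 0 w)) by apply: take_uniq; rewrite wp.
    by [].
  by apply/allP => e /mem_take; apply/allP.
move=> /finite_seqP[l hl].
have /existsP[w /andP[uw cw]] := saw (size l).
have : (size (0%R :: walk 0 w) <= size l)%N.
  apply: uniq_leq_size => // v vw.
  have := mem_walk_connected cw vw.
  by rewrite -[connected_by_open _ _ _ _]/([set x | connected_by_open (@lattice_adj d) c 0 x] v) hl.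
by rewrite /= size_walk size_tuple ltnn.
Qed.

End OpenWalks.

Section FiniteEvents.
Context (R : realType) (disp : measure_display) (T : measurableType disp) (P : probability T R).

Lemma measurable_all (E : eqType) (c : E -> T -> bool) (l : seq E) :
  (forall e, e \in l -> measurable [set w | c e w]) ->
  measurable [set w | all (fun e => c e w) l].
Proof.
elim: l => [|e l IH] ml;
  first by have -> : [set w | all (fun e => c e w) [::]] = setT by apply/seteqP; split.
have -> : [set w | all (fun e => c e w) (e :: l)] =
    [set w | c e w] `&` [set w | all (fun e => c e w) l].
  by apply/seteqP; split => w /=; [move/andP|move/andP].
apply: measurableI; first by apply: ml; rewrite mem_head.
by apply: IH => x xl; apply: ml; rewrite inE xl orbT.
Qed.

Lemma measurable_exists (I : finType) (A : I -> T -> bool) :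
  (forall i, measurable [set w | A i w]) -> measurable [set w | [exists i, A i w]].
Proof.
move=> mA; have -> : [set w | [exists i, A i w]] = \bigcup_(i in [set: I]) [set w | A i w].
  by apply/seteqP; split => w /=; [move/existsP => [i Ai]; exists i|case=> i _ Ai;
    apply/existsP; exists i].
by apply: fin_bigcup_measurable.
Qed.

Lemma prob_exists_le (I : finType) (A : I -> T -> bool) (q : R) :
  (forall i, measurable [set w | A i w]) ->
  (forall i, P [set w | A i w] <= q%:E)%E ->
  (P [set w | [exists i, A i w]] <= (#|I|%:R * q)%:E)%E.
Proof.
move=> mA Aq.
have H (r : seq I) : measurable [set w | has (fun i => A i w) r] /\
    (P [set w | has (fun i => A i w) r] <= ((size r)%:R * q)%:E)%E.
  elim: r => [|i r [mr Pr]].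
    have -> : [set w | has (fun i => A i w) [::]] = set0 by apply/seteqP; split.
    by rewrite measure0 mul0r.
  have -> : [set w | has (fun i => A i w) (i :: r)] =
    [set w | A i w] `|` [set w | has (fun i => A i w) r].
    by apply/seteqP; split => w /=; [move/orP|move/orP].
  split; first exact: measurableU.
  apply: (@le_trans _ _ (P [set w | A i w] + P [set w | has (fun i => A i w) r])%E).
    exact: measureU2.
  by rewrite /= -natr1 mulrDl mul1r addrC EFinD leeD.
have [_] := H (enum I); rewrite -cardE.
congr (_ <= _)%E; congr (P _); apply/seteqP; split => w /=.
  by move/hasP => [i _ Ai]; apply/existsP; exists i.
by move/existsP => [i Ai]; apply/hasP; exists i => //; rewrite mem_enum.
Qed.

End FiniteEvents.

(** * From rung bonds to open bonds *)

Section OpenBonds.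
Variables (R : realType) (d kappa : nat).
Local Notation V := 'rV[int]_d.
Local Notation Dir := ('I_d * bool)%type.
Variables (U : {fset V} -> R) (c : R -> {fset V} -> bool) (p : R).
Hypothesis rule : cdp_rule (@lattice_adj d) kappa U c.
Hypothesis U01 : forall e, bonds (@lattice_adj d) e -> 0 <= U e <= 1.
Hypothesis p1 : p <= 1.
Let xi (e : {fset V}) : bool := U e <= p.

Lemma open_rung t v a : 0 <= t <= 1 -> c t (bond v a) -> U (bond v a) <= t.
Proof.
move=> t01; rewrite /bond (rule t01); first by case/and3P.
by apply/latticeP; exists a.
Qed.

(** Bonds open at a time s <= p have rung by p. The tested bond is counted by [deg] but not by
    [open_degree], which makes the inequality strict. *)
Lemma open_degree_lt s v a : 0 <= s <= p -> xi (bond v a) ->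
  (deg (@bond d) xi v <= kappa)%N ->
  (open_degree (@lattice_adj d) (c s) v (v + step a)%R < kappa)%N.
Proof.
move=> /andP[s0 sp] xa dv; apply: leq_trans dv; rewrite /open_degree.
set S := [set u | _].
pose l := [seq v + step b | b <- enum [pred b | xi (bond v b) & b != a]].
have Sl : S `<=` [set` [fset x in l]%fset].
  move=> u /= [ua /latticeP[b ub] cu]; rewrite !inE; apply/mapP; exists b => //.
  rewrite mem_enum inE; apply/andP; split; last by apply: contraNneq ua => <-; rewrite ub.
  apply: (le_trans _ sp); apply: open_rung; first by rewrite s0 (le_trans sp).
  by rewrite /bond -ub.
have fS : finite_set S by apply: sub_finite_set Sl _; exact: finite_fset.
apply: (@leq_ltn_trans #|` [fset x in l]%fset|).
  apply: fsubset_leq_card; apply/fsubsetP => u; rewrite in_fset_set // inE => Su.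
  exact: Sl.
have : (#|` [fset x in l]%fset| <= size l)%N by rewrite card_fseq size_undup.
move/leq_ltn_trans; apply; rewrite size_map -cardE /deg (cardD1 a [pred b | xi (bond v b)]).
rewrite inE xa add1n ltnS; apply/subset_leq_card/fintype.subsetP => b.
by rewrite !inE andbC.
Qed.

(** The constraint is tested at the clock of the bond, hence no later than p, when few bonds have
    rung at either end. *)
Lemma good_bond_open t v a : p <= t <= 1 -> xi (bond v a) ->
  (deg (@bond d) xi v <= kappa)%N -> (deg (@bond d) xi (v + step a)%R <= kappa)%N ->
  c t (bond v a).
Proof.
move=> /andP[pt t1] xa dv dv'.
have /andP[u0 u1] := U01 (bond_bonds v a).
have up : U (bond v a) <= p := xa.
(* The same bond seen from its other end. *)
pose a' := (a.1, ~~ a.2).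
have va' : v = (v + step a) + step a'.
  apply/matrixP => i j; rewrite !ord1 !add_stepE /=; case: eqP => _; rewrite ?addr0 //.
  by case: a.2 => /=; rewrite ?addrK ?subrK.
have ba' : bond (v + step a) a' = bond v a by rewrite /bond -va' fsetUC.
have t01 : 0 <= t <= 1 by rewrite t1 (le_trans u0 (le_trans up pt)).
rewrite {1}/bond (rule t01); last by apply/latticeP; exists a.
rewrite -/(bond v a); apply/and3P; split.
- exact: le_trans pt.
- by apply: open_degree_lt => //; rewrite u0.
- have := @open_degree_lt (U (bond v a)) (v + step a) a'.
  by rewrite ba' -va'; apply => //; rewrite u0.
Qed.

End OpenBonds.

(** * Vanishing and positivity of the percolation probability *)

Section Process.
Context (R : realType) (d kappa : nat) (disp : measure_display) (T : measurableType disp)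
  (P : probability T R) (U : {fset 'rV[int]_d} -> {RV P >-> R})
  (omega : R -> {fset 'rV[int]_d} -> T -> bool).
Local Notation V := 'rV[int]_d.
Local Notation Dir := ('I_d * bool)%type.
Hypothesis cdp : constrained_degree_percolation (@lattice_adj d) kappa U omega.

Let perc t : set T := [set w | percolates (@lattice_adj d) (fun e => omega t e w) 0].

Lemma walk_bonds_bonds x w e : e \in walk_bonds x w -> bonds (@lattice_adj d) e.
Proof. by case/walk_bondsP => v _ [a [-> _]]; apply: bond_bonds. Qed.

Lemma measurable_percolates t : 0 <= t <= 1 -> measurable (perc t).
Proof.
move=> t01; have [_ mom _] := cdp.
have -> : perc t = \bigcap_n [set w | open_saw n (fun e => omega t e w)].
  by apply/seteqP; split => w; [move/percolatesP => h n _; apply: h|move=> h;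
    apply/percolatesP => n; apply: h].
apply: bigcapT_measurable => n; apply: measurable_exists => s.
case: (uniq _); last first.
  by have -> : [set w | false && all (omega t ^~ w) (walk_bonds 0 s)] = set0 by apply/seteqP; split.
rewrite /=; apply: measurable_all => e /walk_bonds_bonds be.
have := mom t e t01 be measurableT [set true] I; rewrite setTI; congr measurable.
Qed.

(** Finite sets of lattice vertices are countable, so the null sets of the single clocks are united
    along [choice.pickle]. *)
Lemma ae_clocks : {ae P, forall w, forall e, bonds (@lattice_adj d) e -> 0 <= U e w <= 1}.
Proof.
have [iid _ _] := cdp.
have h : {ae P, forall w, forall k : nat, forall e : {fset V}, choice.unpickle k = Some e ->
    bonds (@lattice_adj d) e -> 0 <= U e w <= 1}.
  apply: ae_foralln => k; case: (choice.unpickle k) => [e|]; last by apply: aeW.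
  have [be|nbe] := pselect (bonds (@lattice_adj d) e); last first.
    by apply: aeW => w e' [<-].
  have mU : measurable (U e @^-1` `[0, 1]) by rewrite -[_ @^-1` _]setTI; exact: measurable_funP.
  have nul : P (~` (U e @^-1` `[0, 1])) = 0%E.
    rewrite probability_setC //.
    have := iid.1 e be `[0, 1]%classic (measurable_itv _).
    by rewrite /distribution /pushforward /uniform_prob integral_uniform_pdf1 // => ->;
      rewrite subee.
  exists (~` (U e @^-1` `[0, 1])); split => //; first exact: measurableC.
  move=> w /= nw; rewrite in_itv /= => h; apply: nw => e' [<-] _; exact: h.
by apply: filterS h => w hw e; apply: (hw (choice.pickle e)); rewrite choice.pickleK.
Qed.

(** An explicit null set: adding it to the larger event turns almost sure implications into
    inclusions. *)
Lemma ae_good : exists N : set T, [/\ measurable N, P N = 0%E & forall w, ~ N w ->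
  cdp_rule (@lattice_adj d) kappa (fun e => U e w) (fun t e => omega t e w) /\
  forall e, bonds (@lattice_adj d) e -> 0 <= U e w <= 1].
Proof.
have [_ _ rule] := cdp.
have [N [mN N0 sub]] := filterI rule ae_clocks.
exists N; split => // w nN; apply: contrapT => h; apply: nN; apply: sub => hw.
by apply: h.
Qed.

Lemma theta_eq0 t : 0 <= t <= 1 -> t * d.*2%:R < 1 ->
  theta (@lattice_adj d) 0 P omega t = 0%E.
Proof.
move=> t01 td; have [iid _ _] := cdp; have [N [mN N0 good]] := ae_good.
have t0 : 0 <= t by case/andP: t01.
rewrite /theta -/(perc t); have mperc := measurable_percolates t01.
have bound n : (P (perc t) <= ((t * d.*2%:R) ^+ n)%:E)%E.
  pose A (s : n.-tuple Dir) w := uniq (0 :: walk 0 s) && all (rung U t w) (walk_bonds 0 s).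
  have mA s : measurable [set w | A s w].
    rewrite /A; case: (uniq _); last first.
      by have -> : [set w | false && all (rung U t w) (walk_bonds 0 s)] = set0 by apply/seteqP;
        split.
    by apply: (@measurable_all _ T _ (fun e w => rung U t w e)) => e _; exact: measurable_rung.
  have PA s : (P [set w | A s w] <= (t ^+ n)%:E)%E.
    rewrite /A; have [us|us] := boolP (uniq (0 :: walk 0 s)); last first.
      have -> : [set w | false && all (rung U t w) (walk_bonds 0 s)] = set0 by apply/seteqP; split.
      by rewrite measure0 lee_fin exprn_ge0.
    rewrite /= (prob_all_rung iid t01) ?size_walk_bonds ?size_tuple //.
      exact: walk_bonds_uniq.
    by move=> e; apply: walk_bonds_bonds.
  have := prob_exists_le mA PA.
  rewrite card_tuple card_prod card_ord card_bool muln2 natrX -exprMn mulrC => h.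
  apply: le_trans h; set B := [set w | _].
  have mB : measurable B by exact: measurable_exists.
  have -> : P B = P (B `|` N) by rewrite measureU0.
  apply: le_measure; rewrite ?inE //; first exact: measurableU.
  move=> w pw; have [Nw|nN] := pselect (N w); first by right.
  move/percolatesP: pw => /(_ n)/existsP[s /andP[us os]]; left; apply/existsP; exists s.
  rewrite /A us; apply/allP => e es; have := allP os e es.
  have /walk_bondsP[v _ [a [-> _]]] := es.
  by apply: (open_rung (good w nN).1).
have Pfin : P (perc t) \is a fin_num by apply: fin_num_measure.
have P0 := measure_ge0 P (perc t).
apply/eqP; rewrite eq_le P0 andbT -(fineK Pfin) lee_fin leNgt; apply/negP => x0.
have z1 : `|t * d.*2%:R| < 1 by rewrite ger0_norm // mulr_ge0.
have /cvgrPdist_lt/(_ _ x0)[n _ hn] := cvg_expr z1.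
have := hn n (leqnn n); rewrite /= sub0r normrN ger0_norm ?exprn_ge0 ?mulr_ge0 //.
by apply/negP; rewrite -leNgt -lee_fin fineK.
Qed.

Lemma paths_take m l n (bs : seq (seq Dir)) : bs \in paths d m l n.+1 ->
  take n bs \in paths d m l n.
Proof.
elim: n bs => [|n IH] bs; first by rewrite take0.
rewrite [paths _ _ _ n.+2]/=.
case/allpairsP => -[b bs'] [bb bs'n ->]; rewrite [take _ _]/=.
by apply/allpairsP; exists (b, take n bs'); split => //; apply: IH.
Qed.

Lemma good_block_path_take k n (bs : seq (seq Dir)) c :
  good_block_path k bs c -> good_block_path k (take n bs) c.
Proof.
rewrite /good_block_path /good_path -{1 2}(cat_take_drop n bs) flatten_cat.
rewrite walk_bonds_cat walk_cat all_cat /low_deg -cat_cons all_cat.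
by move=> /andP[/andP[-> _] /andP[-> _]].
Qed.

Lemma level_path m l n (bs : seq (seq Dir)) : bs \in paths d m l n ->
  level m (endpoint 0 (flatten bs)) = n%:Z.
Proof.
suff H x : bs \in paths d m l n -> level m (endpoint x (flatten bs)) = level m x + n%:Z.
  by move/(H 0) ->; rewrite /level big1 ?add0r // => i _; rewrite mxE.
elim: n bs x => [|n IH] bs x; first by rewrite inE => /eqP ->; rewrite /endpoint /=; lia.
case/allpairsP => -[b bs'] /= [/blocksP[bl _] bs'n ->].
by rewrite endpoint_cat IH // level_endpoint //; lia.
Qed.

(** A prefix of a good block path is good, so the events [G n] decrease and continuity from above
    keeps the bound [c0]. No infinite path is extracted: vertices of every level n are reached,
    which makes the cluster infinite. *)
Lemma theta_gt0 (p t c0 : R) m l : 0 < p < 1 -> p <= t <= 1 -> 0 < c0 ->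
  (forall n s, (forall bs, bs \in paths d m l n -> {subset walk_bonds 0 (flatten bs) <= s}) ->
    c0 <= pr p s (fun c => has (fun bs => good_block_path kappa bs c) (paths d m l n))) ->
  (0 < theta (@lattice_adj d) 0%R P omega t)%E.
Proof.
move=> /andP[p0 p1] /andP[pt t1] c00 hc; have [iid _ _] := cdp.
have [N [mN N0 good]] := ae_good.
have t01 : 0 <= t <= 1 by rewrite t1 (le_trans (ltW p0) pt).
have p01 : 0 <= p <= 1 by rewrite !ltW.
pose F n c := has (fun bs => good_block_path kappa bs c) (paths d m l n).
pose G n := [set w | F n (rung U p w)].
pose star (v : V) := [seq bond v a | a <- enum {: Dir}].
(* All bonds at the vertices of the paths are included, because the degree condition reads them. *)
pose s n := undup (flatten [seq flatten [seq star v | v <- 0 :: walk 0 (flatten bs)] |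
  bs <- paths d m l n]).
have mem_s n bs v a : bs \in paths d m l n -> v \in 0 :: walk 0 (flatten bs) ->
    bond v a \in s n.
  move=> bsn vb; rewrite mem_undup; apply/flattenP.
  exists (flatten [seq star v | v <- 0 :: walk 0 (flatten bs)]); first by apply: map_f.
  apply/flattenP; exists (star v); first exact: map_f.
  by apply: map_f; rewrite mem_enum.
have FE n c : F n c = F n (restr (s n) c).
  apply: eq_in_has => bs bsn; rewrite /good_block_path /good_path; congr andb.
    apply: eq_in_all => e /walk_bondsP[v vb [a [-> _]]].
    by rewrite /restr (mem_s _ _ _ _ bsn vb).
  apply: eq_in_all => v vb; congr (_ <= _)%N; apply: eq_card => a.
  by rewrite !inE /restr (mem_s _ _ _ _ bsn vb).
have GE n : G n = [set w | F n (restr (s n) (rung U p w))].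
  by apply/seteqP; split => w; rewrite /G /= -FE.
have mG n : measurable (G n) by rewrite GE; exact: measurable_restr.
have PG n : (c0%:E <= P (G n))%E.
  rewrite GE (prob_restr iid p01) ?undup_uniq ?lee_fin //.
    apply: hc => bs bsn e /walk_bondsP[v vb [a [-> _]]]; exact: mem_s bsn vb.
  move=> e; rewrite mem_undup => /flattenP[? /mapP[bs bsn ->]].
  by case/flattenP => ? /mapP[v _ ->] /mapP[a _ ->]; apply: bond_bonds.
have mcap : measurable (\bigcap_n G n) by exact: bigcapT_measurable.
have Pcap : (c0%:E <= P (\bigcap_n G n))%E.
  have cv : P \o G @ \oo --> P (\bigcap_n G n).
    apply: nonincreasing_cvg_mu => //.
      by rewrite (le_lt_trans (probability_le1 P (mG 0%N))) // ltry.
    apply/nonincreasing_seqP => n; apply/subsetPset => w /hasP[bs bsn gb].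
    apply/hasP; exists (take n bs); first exact: paths_take.
    exact: good_block_path_take.
  rewrite -(cvg_lim _ cv) //; apply: lime_ge; first by apply/cvg_ex; exists (P (\bigcap_n G n)).
  by apply: nearW => n; apply: PG.
have mperc := measurable_percolates t01.
rewrite /theta -/(perc t) -(measureU0 mperc mN N0).
apply: (@lt_le_trans _ _ c0%:E); first by rewrite lte_fin.
apply: le_trans Pcap _; apply: le_measure; rewrite ?inE //; first exact: measurableU.
move=> w Gw; have [Nw|nN] := pselect (N w); [by right|left].
have [rule U01] := good w nN.
have reach n : exists x, connected_by_open (@lattice_adj d) (fun e => omega t e w) 0 x /\
    level m x = n%:Z.
  have /hasP[bs bsn /andP[/allP xi /allP low]] := Gw n I.
  exists (endpoint 0 (flatten bs)); split; last exact: level_path bsn.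
  apply/connected_walk; exists (flatten bs); split => //.
  apply/allP => e eb; have := xi e eb; have /walk_bondsP[v vb [a [-> ub]]] := eb => xa.
  apply: (good_bond_open rule U01 (ltW p1)) => //; first by rewrite pt t1.
    exact: low.
  by apply: low; rewrite inE ub orbT.
rewrite /perc /= /percolates => /finite_seqP[q hq].
(* The sum exceeds the level of every vertex of a finite cluster, up to equality; one more is out of
   reach. *)
have [x [cx lx]] := reach (\sum_(v <- q) `|level m v|%N).+1.
have xq : x \in q.
  by have : [set` q] x by rewrite -hq.
have : (`|level m x| <= \sum_(v <- q) `|level m v|)%N.
  by rewrite (big_rem x) //= leq_addr.
by rewrite lx absz_nat ltnn.
Qed.

End Process.

(** * Bounds on the critical time *)

Section CriticalTime.
Context (R : realType) (d kappa : nat) (disp : measure_display) (T : measurableType disp)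
  (P : probability T R) (U : {fset 'rV[int]_d} -> {RV P >-> R})
  (omega : R -> {fset 'rV[int]_d} -> T -> bool).
Hypothesis cdp : constrained_degree_percolation (@lattice_adj d) kappa U omega.
Local Notation tc := (critical_time (@lattice_adj d) 0 P omega).

Let tset : set R := [set t | 0 <= t <= 1 /\ theta (@lattice_adj d) 0 P omega t = 0%E].

Let tset0 : tset 0.
Proof. by split; [rewrite lexx ler01|apply: (theta_eq0 cdp); rewrite ?lexx ?ler01 // mul0r]. Qed.

Let tset_ub : has_ubound tset.
Proof. by exists 1 => t [/andP[]]. Qed.

Lemma critical_time_ge : (0 < d)%N -> (d.*2%:R)^-1 <= tc.
Proof.
move=> d0; rewrite leNgt; apply/negP => tlt.
have tc0 : 0 <= tc by apply: (ub_le_sup tset_ub tset0).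
have dd0 : 1 <= d.*2%:R :> R by rewrite ler1n double_gt0.
have dd1 : (d.*2%:R)^-1 <= 1 :> R by rewrite invf_le1 // (lt_le_trans ltr01).
pose t := (tc + (d.*2%:R)^-1) / 2.
have t1 : tc < t by rewrite /t; lra.
have t2 : t < (d.*2%:R)^-1 by rewrite /t; lra.
suff : tset t by move/(ub_le_sup tset_ub); rewrite leNgt t1.
have t01 : 0 <= t <= 1 by rewrite (le_trans tc0 (ltW t1)) (le_trans (ltW t2)).
split => //; apply: (theta_eq0 cdp) => //.
by rewrite -ltr_pdivlMr ?mul1r // (lt_le_trans ltr01).
Qed.

Lemma critical_time_le (p : R) :
  (forall t, p <= t <= 1 -> (0 < theta (@lattice_adj d) 0%R P omega t)%E) -> tc <= p.
Proof.
move=> h; apply: ge_sup; first by exists 0.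
move=> t [/andP[t0 t1] th]; rewrite leNgt; apply/negP => pt.
by have := h t; rewrite (ltW pt) t1 th ltxx => /(_ isT).
Qed.

End CriticalTime.

Theorem theorem2 (R : realType) (kappa d : nat -> nat)
  (kappa_infty : kappa n @[n --> \oo] --> \oo)
  (d_infty : d n @[n --> \oo] --> \oo)
  (disp : nat -> measure_display)
  (T : forall n : nat, measurableType (disp n))
  (P : forall n : nat, probability (T n) R)
  (U : forall n : nat, {fset 'rV[int]_(d n)} -> {RV (P n) >-> R})
  (omega : forall n : nat, R -> {fset 'rV[int]_(d n)} -> T n -> bool)
  (cdp : forall n : nat,
     constrained_degree_percolation (@lattice_adj (d n)) (kappa n)
       (U n) (omega n)) :
  (fun n : nat => (d n)%:R *
     critical_time (@lattice_adj (d n)) 0 (P n) (omega n)) @ \oo --> (2^-1 : R).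
Proof.
apply/cvgrPdist_le => e e0.
(* The path construction needs eps <= 1; the final error is at most eps / 2. *)
pose eps := Num.min 1 e.
have eps0 : 0 < eps by rewrite lt_min ltr01.
have [eps1 epse] : eps <= 1 /\ eps <= e by rewrite !ge_min !lexx orbT.
have [c0 [K [D [c00 hKD]]]] := pr_has_good_block_path_ge eps0 eps1.
have hk := (cvgnyPge _).1 kappa_infty K.
have hd := (cvgnyPge _).1 d_infty (maxn D 1).
near=> n.
have kn : (K <= kappa n)%N by near: n; exact: hk.
have : (maxn D 1 <= d n)%N by near: n; exact: hd.
rewrite geq_max => /andP[Dn d1].
have [p01 [m [l [m0 hp]]]] := hKD (kappa n) (d n) kn Dn.
set tc := critical_time _ _ _ _.
have lo : (d n).*2%:R^-1 <= tc := critical_time_ge (cdp n) d1.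
have up : tc <= (1 + eps) / (d n).*2%:R.
  apply: (critical_time_le (cdp n)) => t tp.
  exact: (theta_gt0 (cdp n) p01 tp c00 hp).
have dn0 : 0 < (d n)%:R :> R by rewrite ltr0n.
have d2 : (d n).*2%:R = 2 * (d n)%:R :> R by rewrite -mul2n natrM.
have lo' : 2^-1 <= (d n)%:R * tc.
  rewrite mulrC -ler_pdivrMr //; apply: le_trans lo.
  by rewrite d2 invfM.
have up' : (d n)%:R * tc <= (1 + eps) / 2.
  rewrite mulrC -ler_pdivlMr //; apply: le_trans up _.
  by rewrite d2 invfM mulrA.
rewrite ler_norml; move: lo' up' epse eps0; set z := _ * tc; clear; lra.
Unshelve. all: by end_near.
Qed.
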